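(* Let $d\ge 0$ be an integer and let $X_1, X_2, \ldots$ be independent random variables with a common continuous distribution function $F$. For each $n\ge1$ let $\Pi(n)$ be the class of feasible policies for the sequential selection of a $d$-modal subsequence of $X_1,\dots,X_n$, and for $\pi_n\in\Pi(n)$ let $U^{o,d}_n(\pi_n)$ be the length of the $d$-modal subsequence selected by $\pi_n$. Then for each $n\ge 1$ there is a unique $\pi^*_n \in \Pi(n)$ such that $$\mathbb{E}[U^{o,d}_n(\pi^*_n)] = \sup_{\pi_n \in \Pi(n)}\mathbb{E}[U^{o,d}_n(\pi_n)].$$ Moreover, with $c(d)=2(d+1)$, for all $n\geq 1$ and $d\ge 0$ one has $$c(d)^{1/2} n^{1/2} - c(d)^{3/4} (\pi / 3)^{1/2} n^{1/4} - O(1) < \mathbb{E}[U^{o,d}_n(\pi^*_n)] < c(d)^{1/2} n^{1/2},$$ where $\pi=3.14159\ldots$ and, for each fixed $d$, $O(1)$ denotes a quantity bounded uniformly in $n$. In particular, for each $d\ge0$, $$\mathbb{E}[U^{o,d}_n(\pi^*_n)] \sim \{2(d + 1)\}^{1/2} n^{1/2} \quad \text{as } n\rightarrow \infty.$$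
   Context: A finite sequence $x_1,\dots,x_k$ is called $d$-modal if it makes at most $d$ turns, i.e. it is the concatenation of at most $d+1$ consecutive blocks that are alternately (weakly) increasing, decreasing, increasing, ..., with the first block increasing; blocks may have size one. Thus $d=0$ means $x_1\le\cdots\le x_k$, and $d=1$ means $x_1\le\cdots\le x_t\ge x_{t+1}\ge\cdots\ge x_k$ for some $1\le t\le k$. Let $\mathcal{F}_i=\sigma\{X_1,\dots,X_i\}$, $1\le i\le n$. The variables $X_1,\dots,X_n$ are presented one at a time; when $X_i$ is presented at time $i$ the chooser must irrevocably accept or reject it, using only $X_1,\dots,X_i$. A policy thus yields indices $1\le \tau_1<\cdots<\tau_k\le n$ of selected elements, each $\tau_j$ being a stopping time with respect to $(\mathcal{F}_i)$. A policy is feasible (belongs to $\Pi(n)$) if the selected values $X_{\tau_1},\dots,X_{\tau_k}$ always form a $d$-modal sequence. $U^{o,d}_n(\pi_n)$ is the number $k$ of elements selected by $\pi_n$. Uniqueness of the optimal policy is understood up to null sets: any two optimal policies almost surely select the same elements. *)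

(* Defs.v *)
From HB Require Import structures.
From mathcomp Require Import all_boot all_order all_algebra.
From mathcomp Require Import all_classical all_reals all_analysis.

Set Implicit Arguments.
Unset Strict Implicit.
Unset Printing Implicit Defensive.

Import Order.TTheory GRing.Theory Num.Theory.
Import numFieldNormedType.Exports.

Local Open Scope classical_set_scope.
Local Open Scope ring_scope.

Definition mutually_independent (dT : measure_display) (T : measurableType dT)
    (R : realType) (P : probability T R) (X : nat -> {RV P >-> R}) : Prop :=
  forall (J : seq nat) (B : nat -> set R), uniq J ->
    (forall j, measurable (B j)) ->
    P (\bigcap_(j in [set` J]) (X j @^-1` B j)) =
    (\prod_(j <- J) P (X j @^-1` B j))%E.

(* Blocks are numbered from 0, so the first block is increasing. *)
Definition block_ordered (R : realType) (r : nat) (b : seq R) : bool :=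
  if odd r then sorted (fun x y : R => y <= x) b
  else sorted (fun x y : R => x <= y) b.

(* No order condition links the last entry of a block to the first entry of the
   next one. The empty sequence is d-modal, with no block at all. *)
Definition dmodal (R : realType) (d : nat) (s : seq R) : Prop :=
  exists bs : seq (seq R),
    [/\ s = flatten bs, (size bs <= d.+1)%N, [::] \notin bs &
        forall r, (r < size bs)%N -> block_ordered r (nth [::] bs r)].

(* Times are counted from 0, so [natural_filtration X i] is the sigma-algebra
   generated by X 0, ..., X i. *)
Definition natural_filtration (dT : measure_display) (T : measurableType dT)
    (R : realType) (P : probability T R) (X : nat -> {RV P >-> R}) (i : nat) :
    set (set T) :=
  <<s \bigcup_(j in [set j | (j <= i)%N]) g_sigma_algebra_preimage (X j) >>.

(* [p i w] holds when the i-th presented value is accepted in the outcome [w];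
   the selected indices are the [i] such that [p i w]. *)
Definition policy (T : Type) (n : nat) : Type := 'I_n -> T -> bool.

Definition selected_times (T : Type) (n : nat) (p : policy T n) (w : T) :
    seq 'I_n := [seq i <- enum 'I_n | p i w].

Definition selection (dT : measure_display) (T : measurableType dT)
    (R : realType) (P : probability T R) (X : nat -> {RV P >-> R}) (n : nat)
    (p : policy T n) (w : T) : seq R :=
  [seq X i w | i : 'I_n <- selected_times p w].

Definition selection_length (T : Type) (R : realType) (n : nat)
    (p : policy T n) (w : T) : R :=
  (size (selected_times p w))%:R.

Definition feasible_policies (dT : measure_display) (T : measurableType dT)
    (R : realType) (P : probability T R) (X : nat -> {RV P >-> R})
    (d n : nat) : set (policy T n) :=
  [set p : policy T n | (forall i : 'I_n, natural_filtration X i [set w | p i w]) /\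
           (forall w, dmodal d (selection X p w))].

Definition optimal (dT : measure_display) (T : measurableType dT)
    (R : realType) (P : probability T R) (X : nat -> {RV P >-> R})
    (d n : nat) (p : policy T n) : Prop :=
  feasible_policies X d p /\
  'E_P[selection_length R p]%E =
    ereal_sup [set 'E_P[selection_length R q]%E | q in feasible_policies X d (n := n)].

(* Main.v *)
(* The optimal policy is found by dynamic programming. After the reduction to
   uniform values F(X_i), a state of the selection is described by the number k
   of turns still allowed and by the room u, i.e. the probability that the next
   value can be accepted without a turn; value n k u is the optimal expected
   number of further selections among n observations.

   Verification: the number of selected elements plus the value of the current
   state is a supermartingale for every feasible policy, and a martingale exactly
   when each decision attains the maximum in the Bellman equation; this maximum
   is almost surely attained by one decision only, since value n k is strictly
   increasing for k < n and constant for n <= k.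

   Upper bound: lam * (u + k) + n / (2 * lam) is a supersolution of the Bellman
   equation for each lam > 0; optimize over lam.

   Lower bound: blocks need not be linked, so d + 1 successive optimal monotone
   selections from n / (d + 1) observations each form a d-modal sequence, and
   sqrt (2 n u) - (2 + H_{n-1} / 6), with H the harmonic numbers, is a subsolution
   for d = 0. The error is logarithmic, hence below the required n^{1/4} term. *)

Require Import Defs.
From HB Require Import structures.
From mathcomp Require Import all_boot all_order all_algebra.
From mathcomp Require Import all_classical all_reals all_analysis.
From mathcomp Require Import measurable_realfun ring lra.

Set Implicit Arguments.
Unset Strict Implicit.
Unset Printing Implicit Defensive.

Import Order.TTheory GRing.Theory Num.Theory.
Import numFieldNormedType.Exports.

Local Open Scope classical_set_scope.
Local Open Scope ring_scope.

(** * Uniform laws *)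

Section uniform_law.
Context (d : measure_display) (T : measurableType d) (R : realType).
Variable P : probability T R.

Lemma uniform_prob_ray (y : R) :
  uniform_prob (@ltr01 R) `[y, +oo[ =
  (if y <= 0 then 1 else if y <= 1 then 1 - y else 0)%:E.
Proof.
rewrite /uniform_prob integral_uniform_pdf.
rewrite (eq_integral (fun=> 1%:E)); last first.
  move=> x; rewrite inE => -[_ /=] h; rewrite in_itv/= in h.
  by rewrite /uniform_pdf h subr0 invr1.
rewrite integral_cst//=; last exact: measurableI.
rewrite mul1e; case: ifPn => y0.
  rewrite (_ : _ `&` _ = `[0, 1]%classic).
    by rewrite lebesgue_measure_itv/= lte_fin ltr01 sube0.
  apply/seteqP; split => x /=; rewrite !in_itv/= andbT; first by case.
  by move=> /andP[x0 x1]; rewrite x0 x1 (le_trans y0).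
rewrite -ltNge in y0; case: ifPn => y1.
  rewrite (_ : _ `&` _ = `[y, 1]%classic).
    rewrite lebesgue_measure_itv/= lte_fin; case: ltP => //.
    by move=> y1'; congr (_%:E); lra.
  apply/seteqP; split => x /=; rewrite !in_itv/= andbT.
    by case=> -> /andP[_ ->].
  by move=> /andP[x0 x1]; rewrite x0 x1 (le_trans (ltW y0)).
rewrite -ltNge in y1; rewrite (_ : _ `&` _ = set0) ?measure0//.
apply/seteqP; split => x //=; rewrite !in_itv/= andbT => -[yx /andP[_ x1]].
by have := lt_le_trans y1 (le_trans yx x1); rewrite ltxx.
Qed.

(** Invariance of the uniform law under [x -> 1 - x], read on rays; this reflection later exchanges
    increasing and decreasing blocks. *)
Lemma uniform_prob_onem_ray (y : R) :
  uniform_prob (@ltr01 R) `]-oo, 1 - y] = uniform_prob (@ltr01 R) `[y, +oo[.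
Proof.
rewrite uniform_prob_ray /uniform_prob integral_uniform_pdf.
rewrite (eq_integral (fun=> 1%:E)); last first.
  move=> x; rewrite inE => -[_ /=] h; rewrite in_itv/= in h.
  by rewrite /uniform_pdf h subr0 invr1.
rewrite integral_cst//=; last exact: measurableI.
rewrite mul1e; case: ifPn => y0.
  rewrite (_ : _ `&` _ = `[0, 1]%classic).
    by rewrite lebesgue_measure_itv/= lte_fin ltr01 sube0.
  apply/seteqP; split => x /=; rewrite !in_itv/=; first by case.
  by move=> /andP[x0 x1]; rewrite x0 x1; split => //; lra.
rewrite -ltNge in y0; case: ifPn => y1.
  rewrite (_ : _ `&` _ = `[0, 1 - y]%classic).
    rewrite lebesgue_measure_itv/= lte_fin; case: ltP => [_|].
      by rewrite sube0.
    by move=> y1'; congr (_%:E); lra.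
  apply/seteqP; split => x /=; rewrite !in_itv/=.
    by case=> -> /andP[-> _].
  by move=> /andP[x0 x1]; rewrite x0 x1; split => //; lra.
rewrite -ltNge in y1; rewrite (_ : _ `&` _ = set0) ?measure0//.
apply/seteqP; split => x //=; rewrite !in_itv/= => -[yx /andP[x0 _]].
by move: yx x0; lra.
Qed.

(** Closed upper rays are stable under intersection and generate the Borel sets, so two laws that
    agree on them are equal. *)
Lemma uniform_lawP (Y : T -> R) : measurable_fun setT Y ->
  (forall y, P (Y @^-1` `[y, +oo[) = uniform_prob (@ltr01 R) `[y, +oo[) ->
  forall B, measurable B -> P (Y @^-1` B) = uniform_prob (@ltr01 R) B.
Proof.
move=> mY YE B mB.
pose Ym : {mfun T >-> measurableTypeR R} :=
  HB.pack Y (@isMeasurableFun.Build _ _ T (measurableTypeR R) Y mY).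
apply: (@measure_unique _ R (measurableTypeR R) (@RGenCInfty.G R)
   (fun n => `[(- n%:R)%R, +oo[%classic) _ _ _ _
   (distribution P Ym) (uniform_prob (@ltr01 R))) => //.
- exact: RGenCInfty.measurableE.
- move=> _ _ [x ->] [y ->]; exists (Num.max x y).
  by apply/seteqP; split => z /=; rewrite !in_itv/= !andbT ge_max => /andP.
- by move=> i; exists (- i%:R).
- rewrite -subTset => x _; exists (Num.bound `|x|) => //=.
  rewrite in_itv/= andbT lerNl; apply: ltW.
  by apply: le_lt_trans (archi_boundP _);
    rewrite ?normr_ge0// -[leRHS]normrN ler_norm.
- by move=> _ [x ->]; exact: YE.
- move=> k; rewrite (le_lt_trans (probability_le1 _ _))// ?ltry//.
Qed.

Lemma uniform_law_integral (Y : T -> R) : measurable_fun setT Y ->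
  (forall B, measurable B -> P (Y @^-1` B) = uniform_prob (@ltr01 R) B) ->
  forall h : R -> \bar R, measurable_fun setT h -> (forall x, 0 <= h x)%E ->
  (\int[P]_w h (Y w) = \int[lebesgue_measure]_(x in `[0%R, 1%R]) h x)%E.
Proof.
move=> mY YE h mh h0.
rewrite -[RHS]mul1e -[in 1%:E]invr1 -[in X in X^-1](subr0 1).
rewrite -(integral_uniform (@ltr01 R))//.
pose Ym : {mfun T >-> measurableTypeR R} :=
  HB.pack Y (@isMeasurableFun.Build _ _ T (measurableTypeR R) Y mY).
rewrite -(@ge0_integral_pushforward _ _ _ (measurableTypeR R) _ Y mY P setT) //.
apply: eq_measure_integral => B mB _; exact: YE.
Qed.

Lemma uniform_law_onem (Y : T -> R) :
  (forall B, measurable B -> P (Y @^-1` B) = uniform_prob (@ltr01 R) B) ->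
  forall y, P ((fun w => 1 - Y w) @^-1` `[y, +oo[) =
            uniform_prob (@ltr01 R) `[y, +oo[.
Proof.
move=> YE y; rewrite -uniform_prob_onem_ray -YE//; congr (P _).
by apply/seteqP; split => w /=; rewrite !in_itv/= andbT => h; lra.
Qed.

End uniform_law.

(** * Means under the uniform law on the unit interval *)

Section mean_over_unit_interval.
Context {R : realType}.
Implicit Types (h g f F : R -> R).

Definition umean h : R := \int[lebesgue_measure]_(x in `[0, 1]) h x.

(** Boundedness is asked on the unit interval only, so that all nondecreasing and all continuous
    functions qualify. *)
Definition bmeas h : Prop :=
  measurable_fun setT h /\ exists M, forall x, 0 <= x <= 1 -> `|h x| <= M.

Lemma bmeas_integrable h : bmeas h ->
  (@lebesgue_measure R).-integrable `[0, 1] (EFin \o h).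
Proof.
move=> [mh [M hM]]; apply: measurable_bounded_integrable => //.
- by rewrite /= lebesgue_measure_itv/= lte_fin ltr01 sube0 ltry.
- exact: measurable_funTS.
- exists M; split; first exact: num_real.
  move=> x Mx y /=; rewrite in_itv/= => y01.
  by rewrite (le_trans (hM _ y01))// ltW.
Qed.

Lemma bmeas_cst c : bmeas (fun=> c).
Proof. by split; [exact: measurable_cst | exists `|c|]. Qed.

Lemma bmeasD f g : bmeas f -> bmeas g -> bmeas (fun x => f x + g x).
Proof.
move=> [mf [M fM]] [mg [N gN]]; split; first exact: measurable_funD.
exists (M + N) => x x01; rewrite (le_trans (ler_normD _ _))//.
by rewrite lerD ?fM ?gN.
Qed.

Lemma bmeasN f : bmeas f -> bmeas (fun x => - f x).
Proof.
move=> [mf [M fM]]; split; first exact: measurableT_comp.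
by exists M => x x01; rewrite normrN fM.
Qed.

Lemma bmeas_max f g : bmeas f -> bmeas g -> bmeas (fun x =>
  Num.max (f x) (g x)).
Proof.
move=> [mf [M fM]] [mg [N gN]]; split; first exact: measurable_maxr.
exists (M + N) => x x01.
have := fM _ x01; have := gN _ x01.
have := normr_ge0 (f x); have := normr_ge0 (g x).
by case: (leP (f x) (g x)) => _; lra.
Qed.

Lemma bmeas_if f g (a : R) : bmeas f -> bmeas g ->
  bmeas (fun x => if x <= a then f x else g x).
Proof.
move=> [mf [M fM]] [mg [N gN]]; split.
  by apply: measurable_fun_ifT => //; exact: measurable_fun_ler.
exists (M + N) => x x01.
have := fM _ x01; have := gN _ x01.
have := normr_ge0 (f x); have := normr_ge0 (g x).
by case: ifP => _; lra.
Qed.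

Lemma bmeas_nondecreasing f : {homo f : x y / x <= y} -> bmeas f.
Proof.
move=> fnd; split; first by apply: nondecreasing_measurable => // x y;
  exact: fnd.
exists (`|f 0| + `|f 1|) => x /andP[x0 x1].
have /[1!ler_norml] /andP[] := lexx `|f 0|;
  have /[1!ler_norml] /andP[] := lexx `|f 1|.
have := normr_ge0 (f 0); have := normr_ge0 (f 1).
by have := fnd _ _ x0; have := fnd _ _ x1; rewrite ler_norml => *; apply/andP;
  split; lra.
Qed.

Lemma bmeas_onem f : bmeas f -> bmeas (fun x => f (1 - x)).
Proof.
move=> [mf [M fM]]; split.
  by apply: (measurableT_comp mf); exact: measurable_funB.
by exists M => x /andP[x0 x1]; apply: fM; apply/andP; split; lra.
Qed.

Lemma umean_le f g : bmeas f -> bmeas g ->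
  (forall x, 0 <= x <= 1 -> f x <= g x) -> umean f <= umean g.
Proof.
by move=> bf bg fg; apply: (le_Rintegral _ (bmeas_integrable bf)
  (bmeas_integrable bg)).
Qed.

Lemma eq_umean f g : (forall x, 0 <= x <= 1 -> f x = g x) -> umean f = umean g.
Proof.
by move=> fg; apply: eq_Rintegral => x; rewrite inE/= in_itv/=; exact: fg.
Qed.

Lemma umean_cst c : umean (fun=> c) = c.
Proof.
rewrite /umean Rintegral_cst//= lebesgue_measure_itv/= lte_fin ltr01 sube0/=.
by rewrite mulr1.
Qed.

Lemma umeanD f g : bmeas f -> bmeas g ->
  umean (fun x => f x + g x) = umean f + umean g.
Proof. by move=> bf bg; exact: (RintegralD _ (bmeas_integrable bf)
  (bmeas_integrable bg)). Qed.

Lemma umeanDc f c : bmeas f -> umean (fun x => f x + c) = umean f + c.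
Proof. by move=> bf; rewrite umeanD ?umean_cst//; exact: bmeas_cst. Qed.

(** For nonnegative functions this is [uniform_law_integral], since [1 - x] is uniform too; the
    general case follows by adding a constant. *)
Lemma umean_onem f : bmeas f -> umean (fun x => f (1 - x)) = umean f.
Proof.
suff ge0 g : bmeas g -> (forall x, 0 <= g x) ->
    umean (fun x => g (1 - x)) = umean g.
  move=> bf; have [_ [M fM]] := bf.
  (* Nonnegative everywhere and equal to [f x + M] on the unit interval. *)
  pose g x := Num.max 0 (f x + M).
  have bg : bmeas g by apply: bmeas_max; [|apply: bmeasD => //];
    exact: bmeas_cst.
  have gE x : 0 <= x <= 1 -> g x = f x + M.
    move=> /fM; rewrite ler_norml => /andP[h _].
    by rewrite /g; case: leP => //; lra.
  have := ge0 g bg; rewrite (eq_umean (f := g) (g := fun x => f x + M))//.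
  rewrite (eq_umean (f := fun x => g (1 - x)) (g := fun x => f (1 - x) + M));
    last first.
    by move=> x /andP[x0 x1]; rewrite gE//; apply/andP; split; lra.
  rewrite !umeanDc//; last exact: bmeas_onem.
  move=> h; apply: (addIr M); apply: h.
  by move=> x; rewrite /g le_max lexx.
move=> bg g0; rewrite /umean /Rintegral; congr fine.
have [mg _] := bg; have [mg' _] := bmeas_onem bg.
have mI := @measurable_id _ R setT.
have mO : measurable_fun setT (fun x : R => 1 - x) by exact: measurable_funB.
rewrite -(@uniform_law_integral _ _ R (uniform_prob ltr01) id mI _
    (fun x => (g (1 - x))%:E)) => //; last first.
- by move=> x; rewrite lee_fin.
- exact/measurable_EFinP.
rewrite (@uniform_law_integral _ _ R (uniform_prob ltr01) _ mO _
    (fun x => (g x)%:E)) => //.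
  by apply: uniform_lawP => //; apply: uniform_law_onem.
exact/measurable_EFinP.
Qed.

(** Equal means would make the nonnegative difference vanish almost everywhere, against the positive
    length of []a, b[]. *)
Lemma umean_lt f g (a b : R) : bmeas f -> bmeas g ->
  (forall x, 0 <= x <= 1 -> f x <= g x) -> 0 <= a -> a < b -> b <= 1 ->
  (forall x, a < x < b -> f x < g x) -> umean f < umean g.
Proof.
move=> bf bg fg a0 ab b1 fgab.
rewrite lt_neqAle umean_le// andbT; apply/eqP => E.
have bh : bmeas (fun x => g x + - f x) by apply: bmeasD => //; exact: bmeasN.
have : umean (fun x => g x + - f x) = 0.
  rewrite umeanD ?E//; last exact: bmeasN.
  by rewrite -E -umeanD// ?(eq_umean (g := fun=> 0)) ?umean_cst// => [x _|];
    [rewrite subrr|exact: bmeasN].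
move=> /eqP; rewrite /umean /Rintegral fine_eq0; last first.
  exact: integrable_fin_num (bmeas_integrable bh).
move=> /eqP h0.
have mh : measurable_fun (`[0,
  1]%classic : set (measurableTypeR R)) (fun x => (g x + - f x)%:E).
  by apply/measurable_EFinP; apply: measurable_funTS; case: bh.
have : (\int[lebesgue_measure]_(x in `[0%R, 1%R]) `|(g x + - f x)%:E| = 0)%E.
  rewrite -[RHS]h0; apply: eq_integral => x; rewrite inE/= in_itv/= => x01.
  by rewrite /= ger0_norm// subr_ge0 fg.
move=> /(ae_eq_integral_abs _ _ mh)[]// N [mN N0 sub].
have : (lebesgue_measure `]a, b[ <= lebesgue_measure N)%E.
  apply: le_measure; rewrite ?inE//; move=> x /=; rewrite in_itv/= => xab.
  apply: sub => /= H; have := fgab _ xab.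
  rewrite -subr_gt0 => /lt0r_neq0/eqP; apply.
  have /H[] : x \in `[0, 1] by rewrite in_itv/=; apply/andP; split; lra.
  by [].
rewrite N0 /= lebesgue_measure_itv/= lte_fin ab lee_fin.
by rewrite leNgt subr_gt0 ab.
Qed.

End mean_over_unit_interval.

(** * The value function *)

Section value_function.
Context {R : realType}.
Implicit Types (V : nat -> R -> R) (n m k : nat) (u x : R).

(* Value after accepting x: when k turns are left and the next value is accepted
   without a turn on a set of mass u, x runs over the unit interval so that
   x <= u is accepted without a turn and leaves room x, while x > u uses a turn
   and leaves room 1 - x in the opposite direction. The value -2 forbids a turn
   when k = 0, since 1 - 2 lies strictly below every V k u >= 0. *)
Definition vnext V k u x : R :=
  if x <= u then V k x else if k is k'.+1 then V k' (1 - x) else -2.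

Definition bellman V k u : R :=
  umean (fun x => Num.max (V k u) (1 + vnext V k u x)).

Fixpoint value n : nat -> R -> R :=
  if n is m.+1 then bellman (value m) else fun _ _ => 0.

Definition nondecreasing_in_room V := forall k, {homo V k : x y / x <= y}.

Lemma bmeas_vnext V k u : nondecreasing_in_room V -> bmeas (vnext V k u).
Proof.
move=> Vnd; apply: bmeas_if; first exact: bmeas_nondecreasing.
case: k => [|k]; first exact: bmeas_cst.
exact/bmeas_onem/bmeas_nondecreasing.
Qed.

Lemma bmeas_bellman V k u c : nondecreasing_in_room V ->
  bmeas (fun x => Num.max c (1 + vnext V k u x)).
Proof.
move=> Vnd; apply: bmeas_max; first exact: bmeas_cst.
by apply: bmeasD; [exact: bmeas_cst|exact: bmeas_vnext].
Qed.

Lemma bellman_ge V k u : nondecreasing_in_room V -> V k u <= bellman V k u.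
Proof.
move=> Vnd; rewrite -[leLHS]umean_cst.
apply: umean_le; [exact: bmeas_cst|exact: bmeas_bellman|].
by move=> x _; rewrite le_max lexx.
Qed.

(** The invariant by which a turn never beats acceptance without one:
    [V k (1 - x) <= V k 1 <= V k.+1 x]. *)
Definition fresh_block_le V := forall k u, V k 1 <= V k.+1 u.

(** Only [u < x <= u'] needs an argument: there [x] costs a turn under [u] and none under [u'], and
    [fresh_block_le] compares the outcomes. With no turn left, [-2] lies below every value. *)
Lemma vnext_le V k u u' x : nondecreasing_in_room V -> fresh_block_le V ->
  (forall k u, 0 <= V k u) -> u <= u' -> 0 <= x <= 1 ->
  vnext V k u x <= vnext V k u' x.
Proof.
move=> Vnd Vf V0 uu' /andP[x0 x1]; rewrite /vnext; case: ifPn => xu.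
  by rewrite (le_trans xu uu').
case: ifPn => xu' //; case: k => [|k]; first by rewrite (@le_trans _ _ 0)//;
  lra.
by rewrite (le_trans _ (Vf _ _))// Vnd//; lra.
Qed.

(** One induction carries all three properties because monotonicity in the room uses the other two
    one step earlier. *)
Lemma value_spec n : [/\ nondecreasing_in_room (value n),
  fresh_block_le (value n) & forall k u, 0 <= value n k u <= n%:R].
Proof.
elim: n => [|n [Vnd Vf V01]].
  by split => [k x y _|k u|k u] //=; rewrite lexx.
have V0 k u : 0 <= value n k u by have /andP[] := V01 k u.
split => [k u u' uu'|k u|k u] /=.
- apply: umean_le; [exact: bmeas_bellman..|] => x x01.
  have h1 := Vnd k _ _ uu'; have h2 := vnext_le k Vnd Vf V0 uu' x01.
  rewrite ge_max !le_max h1/=; apply/orP; right; lra.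
(* Reflection: where the left side sees [x], the right side sees [1 - x], and a turn there leaves
   room [x], as on the left side. *)
- rewrite /bellman -[leRHS]umean_onem; last exact: bmeas_bellman.
  apply: umean_le; [exact: bmeas_bellman|exact: bmeas_onem (bmeas_bellman k.+1
    u _ Vnd)|].
  move=> x /andP[x0 x1]; rewrite /vnext x1.
  rewrite ge_max !le_max Vf/=; case: ifPn => xu.
    apply/orP; right; have := Vf k (1 - x); have := Vnd k _ _ x1; lra.
  by apply/orP; right; rewrite subKr.
- rewrite (le_trans (V0 k u))/=; last exact: bellman_ge.
  rewrite -[leRHS]umean_cst.
  apply: umean_le; [exact: bmeas_bellman|exact: bmeas_cst|] => x x01.
  rewrite ge_max -natr1; have /andP[_ h] := V01 k u.
  apply/andP; split; first lra.
  rewrite /vnext; case: ifP => _; first by have /andP[_ h'] := V01 k x; lra.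
  case: k h => [|k] h; last by have /andP[_ h'] := V01 k (1 - x); lra.
  have : (0 : R) <= n%:R by []; lra.
Qed.

Lemma value_nd n : nondecreasing_in_room (value n).
Proof. by have [] := value_spec n. Qed.

Lemma value_fresh n : fresh_block_le (value n).
Proof. by have [] := value_spec n. Qed.

Lemma value_ge0 n k u : 0 <= value n k u.
Proof. by have [_ _ /(_ k u)/andP[]] := value_spec n. Qed.

Lemma value_le n k u : value n k u <= n%:R.
Proof. by have [_ _ /(_ k u)/andP[]] := value_spec n. Qed.

(** Each acceptance costs at most one turn, so with as many turns as observations nothing has to be
    rejected. *)
Lemma value_many_turns n k u : (n <= k)%N -> value n k u = n%:R.
Proof.
elim: n k u => [//|n IH] k u nk /=.
rewrite /bellman (eq_umean (g := fun=> n.+1%:R)) ?umean_cst// => x x01.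
rewrite IH ?(ltnW nk)// (_ : vnext _ _ _ _ = n%:R); last first.
  rewrite /vnext; case: ifP => _; first by rewrite IH// ltnW.
  by case: k nk => // k nk; rewrite IH.
by rewrite nat1r; apply/max_idPr; rewrite ler_nat.
Qed.

(** Strictness comes from the observations [u < x < u'], accepted without a turn under the larger
    room only: there [1 + V k x] beats rejection and, by induction, also the turn. *)
Lemma value_lt n k u u' : (k < n)%N -> 0 <= u -> u < u' -> u' <= 1 ->
  value n k u < value n k u'.
Proof.
elim: n k u u' => [//|n IH] k u u' kn u0 uu' u1 /=.
have Vnd := @value_nd n; have Vf := @value_fresh n; have V0 := @value_ge0 n.
apply: (umean_lt (a := u) (b := u')) => //; try exact: bmeas_bellman.
  move=> x x01; have h1 := Vnd k _ _ (ltW uu').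
  have h2 := vnext_le k Vnd Vf V0 (ltW uu') x01.
  by rewrite ge_max !le_max h1/=; apply/orP; right; lra.
move=> x /andP[ux xu]; rewrite gt_max !lt_max.
rewrite /vnext (ltW xu) leNgt ux/=; apply/andP; split; apply/orP; right.
  by have := Vnd k _ _ (ltW ux); lra.
case: k kn => [|k] kn; first by have := V0 0%N x; lra.
have : value n k (1 - x) < value n k 1 by apply: IH => //; lra.
by have := Vf k x; lra.
Qed.

(* Spend m observations without a turn, then turn and start a block afresh. *)
Lemma value_concat m j k u :
  value m 0 u + value j k 1 <= value (m + j) k.+1 u.
Proof.
elim: m u => [|m IH] u; first by rewrite add0r add0n; exact: value_fresh.
rewrite addSn /= -umeanDc; last exact/bmeas_bellman/value_nd.
have nd1 := @value_nd m; have nd2 := @value_nd (m + j).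
apply: umean_le; [|exact: bmeas_bellman|] => [|x x01].
  by apply: bmeasD; [exact: bmeas_bellman|exact: bmeas_cst].
rewrite addr_maxl ge_max !le_max IH/= /vnext; case: ifPn => xu.
  by apply/orP; right; have := IH x; lra.
apply/orP; left; have := IH u; have := value_ge0 m 0 u; lra.
Qed.

(** [value_concat] is iterated over blocks of [m] observations; the leftover ones do no harm, the
    value being nondecreasing in [n]. *)
Lemma value_ge_blocks n d m : (d.+1 * m <= n)%N ->
  d.+1%:R * value m 0 1 <= value n d 1.
Proof.
have step n' k u : value n' k u <= value n'.+1 k u.
  exact/bellman_ge/value_nd.
have mono k u : {homo (fun n => value n k u) : a b / (a <= b)%N >-> a <= b}.
  by apply: homo_leq => // ? ? ?; exact: le_trans.
move=> h; apply: le_trans (mono _ _ _ _ h) => {h n}.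
elim: d => [|d IH]; first by rewrite mul1n mul1r.
rewrite mulSn; apply: le_trans (value_concat _ _ _ _).
by rewrite -nat1r mulrDl mul1r lerD2l.
Qed.

Lemma valueS n k u : value n.+1 k u = bellman (value n) k u.
Proof. by []. Qed.

End value_function.
Arguments value : simpl never.

(** * Derivatives and integrals of the comparison functions *)

Section calculus.
Context {R : realType}.
Implicit Types (f g F : R -> R).

(** Serves the square of the positive part, which is differentiable at 0 although the positive part
    is not. *)
Lemma is_derive_quadratic_error F (x l K : R) :
  (forall h, `|F (h + x) - F x - h * l| <= K * h ^+ 2) -> is_derive x 1 F l.
Proof.
move=> FK.
have cvgl : (fun h : R => h^-1 *: ((F \o shift x) (h *: (1 : R)) - F x)) @ 0^'
  --> l.
  apply/cvgrPdist_le => /= e e0.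
  near=> h.
  have h0 : h != 0 by near: h; exact: nbhs_dnbhs_neq.
  have -> : l - h^-1 *: (F (h *: (1 : R) + x) - F x) =
      - (h^-1 * (F (h + x) - F x - h * l)).
    by rewrite /GRing.scale/= mulr1; field.
  rewrite normrN normrM normfV ler_pdivrMl ?normr_gt0//.
  apply: (le_trans (FK h)).
  rewrite -[h ^+ 2]real_normK ?num_real// expr2 mulrA mulrC.
  rewrite ler_wpM2l//.
  apply: (@le_trans _ _ ((`|K| + 1) * `|h|)).
    by rewrite ler_wpM2r// (le_trans (ler_norm _))// lerDl.
  rewrite mulrC -ler_pdivlMr ?ltr_wpDl//.
  near: h; apply: dnbhs0_le; rewrite divr_gt0// ltr_wpDl//.
by apply: DeriveDef; [apply/cvg_ex; exists l | exact: cvg_lim].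
Unshelve. all: by end_near. Qed.

Lemma FTC_Rintegral f F (a b : R) : a <= b ->
  continuous f -> continuous F ->
  (forall x, a < x < b -> is_derive x 1 F (f x)) ->
  \int[lebesgue_measure]_(x in `[a, b]) f x = F b - F a.
Proof.
rewrite le_eqVlt => /predU1P[<- _ _ _|ab cf cF F'].
  by rewrite set_itv1 Rintegral_set1 subrr.
rewrite /Rintegral (continuous_FTC2 (F := F))//.
- exact: continuous_subspaceT.
- split; first by move=> x; rewrite in_itv/= => /F' [].
  + exact/cvg_at_right_filter/cF.
  + exact/cvg_at_left_filter/cF.
- by move=> x; rewrite in_itv/= => /F' xF; rewrite derive1E; exact: derive_val.
Qed.

Lemma umean_if f g (u : R) : 0 <= u <= 1 -> bmeas f -> bmeas g ->
  umean (fun x => if x <= u then f x else g x) =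
  \int[lebesgue_measure]_(x in `[0, u]) f x +
  \int[lebesgue_measure]_(x in `[u, 1]) g x.
Proof.
move=> /andP[u0 u1] bf bg.
have bh := bmeas_if u bf bg.
have ih := bmeas_integrable bh; have ig := bmeas_integrable bg.
have := Rintegral_itvB (x := u) ih; rewrite !bnd_simp => /(_ u0 u1) E.
rewrite /umean -[LHS](subrK (\int[lebesgue_measure]_(x in `[0, u])
   (if x <= u then f x else g x))) E addrC; congr (_ + _).
  by apply: eq_Rintegral => x; rewrite inE/= in_itv/= => /andP[_ ->].
rewrite -Rintegral_itv_obnd_cbnd; last first.
  by apply: integrableS ig => // x /=; rewrite !in_itv/= => /andP[h ->];
    rewrite (le_trans u0 (ltW h)).
apply: eq_Rintegral => x; rewrite inE/= in_itv/= => /andP[h _].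
by rewrite leNgt h.
Qed.

Lemma umean_ge_itv f g (a b : R) : 0 <= a -> b <= 1 -> bmeas f -> bmeas g ->
  (forall x, 0 <= x <= 1 -> 0 <= g x) ->
  (forall x, a <= x <= b -> f x <= g x) ->
  \int[lebesgue_measure]_(x in `[a, b]) f x <= umean g.
Proof.
move=> a0 b1 bf bg g0 fg.
have sub : `[a, b]%classic `<=` (`[0, 1]%classic : set (measurableTypeR R)).
  by move=> x /=; rewrite !in_itv/= => /andP[ax xb];
    rewrite (le_trans a0)//= (le_trans xb).
have ig := bmeas_integrable bg; have if_ := bmeas_integrable bf.
have ig' : lebesgue_measure.-integrable `[a,
  b] (EFin \o g) by exact: integrableS ig.
apply: (@le_trans _ _ (\int[lebesgue_measure]_(x in `[a, b]) g x)).
  by apply: le_Rintegral => //; exact: integrableS if_.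
rewrite /umean /Rintegral fine_le//;
  [exact: integrable_fin_num ig'|exact: integrable_fin_num ig|].
apply: ge0_subset_integral => //.
by apply/measurable_EFinP; apply: measurable_funTS; case: bg.
Qed.

Lemma is_derive_posr_sqr (x : R) :
  is_derive x 1 (fun y => Num.max 0 y ^+ 2) (2 * Num.max 0 x).
Proof.
apply: (@is_derive_quadratic_error _ _ _ 1) => h.
rewrite ler_norml; case: (leP 0 (h + x)); case: (leP 0 x) => *;
  by apply/andP; split; nra.
Qed.

Lemma continuous_posr_affine (p q : R) : continuous (fun x =>
  Num.max 0 (p + q * x)).
Proof.
move=> x; apply: (@continuous_max _ _ (fun=> 0) (fun x => p + q * x) x);
  first exact: cst_continuous.
apply: continuousD; first exact: cst_continuous.
by apply: continuousM; [exact: cst_continuous|exact: cvg_id].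
Qed.

(** The squared positive part over [2 * q] is a primitive; one formula serves both signs of the
    slope. *)
Lemma integral_posr_affine (p q a b : R) : q != 0 -> a <= b ->
  \int[lebesgue_measure]_(x in `[a, b]) Num.max 0 (p + q * x) =
  (Num.max 0 (p + q * b) ^+ 2 - Num.max 0 (p + q * a) ^+ 2) / (2 * q).
Proof.
move=> q0 ab.
pose F x : R := (2 * q)^-1 * Num.max 0 (p + q * x) ^+ 2.
have dF (x : R) : is_derive x 1 F (Num.max 0 (p + q * x)).
  have d1 : is_derive x 1 (fun x : R => p + q * x) q.
    by apply: is_derive_eq; rewrite /GRing.scale/=; ring.
  have d2 := @is_derive1_comp _ (fun y => Num.max 0 y ^+ 2) (fun x =>
    p + q * x) _ _ _
    (is_derive_posr_sqr (p + q * x)) d1.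
  have d3 := is_deriveZ (2 * q)^-1 d2.
  by apply: (is_derive_eq d3); rewrite /GRing.scale/=; field.
rewrite (@FTC_Rintegral _ F) //.
- by rewrite /F; field.
- exact: continuous_posr_affine.
- move=> x; apply: differentiable_continuous; apply/derivable1_diffP.
  by have [] := dF x.
Qed.

Lemma bmeas_continuous f : continuous f -> bmeas f.
Proof.
move=> cf; split; first exact: continuous_measurable_fun.
have : compact (f @` `[0, 1]).
  by apply: continuous_compact;
    [exact: continuous_subspaceT|exact: segment_compact].
move=> /compact_bounded[M [_ hM]]; exists (M + 1) => x x01.
by apply: (hM (M + 1)); [rewrite ltrDl|exists x => //=; rewrite in_itv].
Qed.

End calculus.

(** * Bounds on the value function *)

Section value_bounds.
Context {R : realType}.
Implicit Types (n m k : nat) (u x lam : R).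

Lemma value1_le_room u : 0 <= u <= 1 -> value 1 0 u <= u.
Proof.
move=> u01; have /andP[u0 u1] := u01.
rewrite valueS /bellman (eq_umean (g := fun x => if x <= u then 1 else 0));
  last first.
  move=> x x01; rewrite /vnext /value; case: ifP => _.
    by rewrite addr0; apply/max_idPr.
  by apply/max_idPl; lra.
rewrite umean_if//; [|exact: bmeas_cst..].
rewrite !Rintegral_cst//= !lebesgue_measure_itv/= mul0r addr0 mul1r lte_fin.
by case: ifP => // _; rewrite sube0.
Qed.

Lemma value1_le k u : value 1 k u <= 1.
Proof. exact: value_le. Qed.

(* The gain 1 + V(new) - V(old) under the linear candidate V = lam * room is
   1 - lam * (room lost), and the set of values costing less than z has mass at
   most z; hence the expected positive part is at most 1 / (2 lam). *)
Lemma mean_linear_gain_le lam u : 0 < lam -> 0 <= u <= 1 ->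
  umean (fun x => if x <= u then Num.max 0 ((1 - lam * u) + lam * x)
                  else Num.max 0 (1 + (- lam) * x)) <= (2 * lam)^-1.
Proof.
move=> lam0 u01; have /andP[u0 u1] := u01.
have lam1 : lam != 0 by rewrite gt_eqF.
rewrite umean_if//; try exact/bmeas_continuous/continuous_posr_affine.
rewrite !integral_posr_affine ?oppr_eq0//.
rewrite (_ : 1 - lam * u + lam * u = 1); last ring.
rewrite (_ : 1 + - lam * u = 1 - lam * u + lam * 0); last ring.
rewrite (max_idPr ler01).
set A := Num.max 0 _; set B := Num.max 0 _.
rewrite (_ : _ + _ = (2 * lam)^-1 - B ^+ 2 / (2 * lam)); last by field.
by rewrite lerBlDr lerDl divr_ge0 ?sqr_ge0// mulr_ge0// ltW.
Qed.

(** The slack [e] depends on [lam] only and makes the final upper bound strict. The induction starts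
    at one observation, because with none the linear bound is attained at [u = k = 0]. *)
Lemma value_lt_linear lam : 0 < lam -> exists2 e, 0 < e &
  forall n k u, 0 <= u <= 1 ->
    value n.+1 k u <= lam * (u + k%:R) + n.+1%:R / (2 * lam) - e.
Proof.
move=> lam0; have lam1 : lam != 0 by rewrite gt_eqF.
have i0 : 0 < (2 * lam)^-1 by rewrite invr_gt0 mulr_gt0.
have amgm : 1 < lam + (2 * lam)^-1.
  rewrite -subr_gt0 (_ : _ - _ = ((lam - 1) ^+ 2 + (lam ^+ 2)) / (2 * lam));
    last by field.
  by rewrite divr_gt0 ?mulr_gt0// ltr_wpDl ?sqr_ge0// exprn_gt0.
(* The slack of the one-observation case: the first entry is used for [k = 0] and [lam > 1], the
   second otherwise. *)
exists (Num.min (2 * lam)^-1 (lam + (2 * lam)^-1 - 1)).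
  by rewrite lt_min i0 subr_gt0 amgm.
set e := Num.min _ _.
have e1 : e <= (2 * lam)^-1 by rewrite ge_min lexx.
have e2 : e <= lam + (2 * lam)^-1 - 1 by rewrite ge_min lexx orbT.
elim=> [|n IH] k u u01; have /andP[u0 u1] := u01.
  rewrite mul1r; case: k => [|k].
    rewrite addr0; move: e e1 e2 => e e1 e2; have := value1_le_room u01;
      have [h|h] := leP lam 1.
      have : 0 <= (1 - u) * (1 - lam) by rewrite mulr_ge0// subr_ge0.
      lra.
    have : 0 <= u * (lam - 1) by rewrite mulr_ge0// subr_ge0 ltW.
    lra.
  have h : (1 : R) <= k.+1%:R by rewrite ler1n.
  have : lam * 1 <= lam * (u + k.+1%:R) by rewrite ler_wpM2l ?(ltW lam0)//; lra.
  by have := value1_le k.+1 u; lra.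
set A : R := lam * (u + k%:R) + n.+1%:R / (2 * lam) - e.
have nd := @value_nd R n.+1.
have bg : bmeas (fun x => if x <= u then Num.max 0 ((1 - lam * u) + lam * x)
                  else Num.max 0 (1 + (- lam) * x)).
  by apply: bmeas_if; exact/bmeas_continuous/continuous_posr_affine.
apply: (@le_trans _ _ (umean (fun x =>
  (if x <= u then Num.max 0 ((1 - lam * u) + lam * x)
                  else Num.max 0 (1 + (- lam) * x)) + A))).
  rewrite valueS /bellman.
  apply: umean_le; [exact: bmeas_bellman|by apply: bmeasD => //;
    exact: bmeas_cst|].
  move=> x x01; have /andP[x0 x1] := x01.
  have VA := IH k u u01; rewrite -/A in VA.
  have V0 := @value_ge0 R n.+1 k u.
  rewrite ge_max; apply/andP; split.
    rewrite (le_trans VA)// lerDr; case: ifP => _; by rewrite le_max lexx.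
  rewrite /vnext; case: ifP => [xu|/negbT].
    have := IH k x x01; have : 1 - lam * u + lam * x <= Num.max 0 (1 - lam * u
      + lam * x).
      by rewrite le_max lexx orbT.
    rewrite /A; lra.
  rewrite -ltNge => ux; have h : 1 + - lam * x <= Num.max 0 (1 + - lam * x).
    by rewrite le_max lexx orbT.
  case: k @A VA V0 => [|k] A VA V0.
    have : 0 <= Num.max 0 (1 + - lam * x) by rewrite le_max lexx.
    lra.
  have x01' : 0 <= 1 - x <= 1 by apply/andP; split; lra.
  (* Under the linear candidate a turn loses [lam * (u + x)], at least the [lam * x] integrated in
     [mean_linear_gain_le]. *)
  by have := IH k _ x01'; rewrite /A -natr1; nra.
rewrite umeanDc//; have := mean_linear_gain_le lam0 u01.
have -> : n.+2%:R / (2 * lam) = n.+1%:R / (2 * lam) + (2 * lam)^-1.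
  by rewrite -natr1; field.
rewrite /A; lra.
Qed.

Lemma value_lt_sqrt n d : (0 < n)%N ->
  value n d 1 < Num.sqrt (2 * d.+1%:R) * Num.sqrt (n%:R : R).
Proof.
case: n => // n _; set s := _ * _.
have s0 : 0 < s by rewrite mulr_gt0 ?sqrtr_gt0 ?mulr_gt0// ltr0n.
have ssq : s ^+ 2 = 2 * d.+1%:R * n.+1%:R.
  by rewrite /s exprMn !sqr_sqrtr ?mulr_ge0.
(* This choice of [lam] balances the bound: [lam * (1 + d)] and [n.+1 / (2 * lam)] both equal
   [s / 2]. *)
have l0 : 0 < n.+1%:R / s by rewrite divr_gt0// ltr0n.
have [e e0 /(_ n d 1)] := value_lt_linear l0.
rewrite ler01 lexx => /(_ isT) /le_lt_trans; apply.
rewrite nat1r (_ : n.+1%:R / s * d.+1%:R = s / 2); last first.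
  have sn0 : s != 0 by rewrite gt_eqF.
  apply: (mulIf sn0); rewrite (_ : s / 2 * s = s ^+ 2 / 2); last by field.
  by rewrite ssq; field.
rewrite (_ : n.+1%:R / (2 * (n.+1%:R / s)) = s / 2); first by lra.
have N0 : (n.+1%:R : R) != 0 by rewrite pnatr_eq0.
have sn0 : s != 0 by rewrite gt_eqF.
by move: (n.+1%:R : R) N0 => N N0; field; rewrite N0 sn0.
Qed.

(** The 2 makes the lower bound trivial for one observation. Passing from [j] to [j.+1] observations
    loses [(3 * a ^+ 2)^-1 = 1 / (6 * j)], where [a ^+ 2 = 2 * j]. *)
Definition value_defect n : R := 2 + (\sum_(1 <= j < n) j%:R^-1) / 6.

Lemma continuous_sqrt_affine (p q : R) : continuous (fun x =>
  p + q * Num.sqrt x).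
Proof.
move=> x; apply: cvgD; first exact: cvg_cst.
by apply: cvgM; [exact: cvg_cst|exact: sqrt_continuous].
Qed.

Lemma integral_sqrt_affine (p q a b : R) : 0 <= a -> a <= b ->
  \int[lebesgue_measure]_(x in `[a, b]) (p + q * Num.sqrt x) =
  p * (b - a) + 2 / 3 * q * (Num.sqrt b ^+ 3 - Num.sqrt a ^+ 3).
Proof.
move=> a0 ab.
pose F x : R := p * x + 2 / 3 * q * Num.sqrt x ^+ 3.
have dF x : a < x < b -> is_derive x 1 F (p + q * Num.sqrt x).
  move=> /andP[ax _]; have x0 : 0 < x by exact: le_lt_trans ax.
  have s0 : Num.sqrt x != 0 by rewrite gt_eqF// sqrtr_gt0.
  have ds := is_derive1_sqrt x0.
  apply: is_derive_eq.
  rewrite /GRing.scale/=; field.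
  done.
have cF : continuous F.
  move=> x; apply: cvgD; first by apply: cvgM; [exact: cvg_cst|exact: cvg_id].
  apply: cvgM; first exact: cvg_cst.
  apply: (@continuous_comp _ _ _ Num.sqrt (fun y => y ^+ 3)).
    exact: sqrt_continuous.
  exact: exprn_continuous.
rewrite (FTC_Rintegral ab (@continuous_sqrt_affine p q) cF dF) /F; ring.
Qed.

(* With V u = a * sqrt u the optimal acceptance window above c satisfies
   sqrt u - sqrt c = 1 / a, cut at 0 when a * sqrt u < 1. *)
Lemma mean_sqrt_gain_ge (a u : R) : 0 < a -> 0 <= u <= 1 ->
  Num.sqrt u / a - (3 * a ^+ 2)^-1 <=
  umean (fun x => if x <= u then Num.max 0 ((1 - a * Num.sqrt u) + a * Num.sqrt
    x) else 0).
Proof.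
move=> a0 /andP[u0 u1]; have an0 : a != 0 by rewrite gt_eqF.
set r := Num.sqrt u; have r0 : 0 <= r by exact: sqrtr_ge0.
have ur : u = r ^+ 2 by rewrite sqr_sqrtr.
pose c := Num.max 0 (r - a^-1).
have c0 : 0 <= c by rewrite le_max lexx.
have ia0 : 0 < a^-1 by rewrite invr_gt0.
have cr : c <= r by rewrite ge_max r0/=; lra.
have csu : c ^+ 2 <= u by rewrite ur ler_sqr.
have bp : bmeas (fun x => 1 - a * r + a * Num.sqrt x).
  exact/bmeas_continuous/continuous_sqrt_affine.
apply: le_trans (umean_ge_itv (f := fun x => 1 - a * r + a * Num.sqrt x)
   (a := c ^+ 2) (b := u) _ _ _ _ _ _) => //; first last.
- by move=> x /andP[_ ->]; rewrite le_max lexx orbT.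
- by move=> x _; case: ifP => _ //; rewrite le_max lexx.
- by apply: bmeas_if; [apply: bmeas_max => //|]; exact: bmeas_cst.
- exact: sqr_ge0.
rewrite integral_sqrt_affine ?sqr_ge0// sqrtr_sqr (ger0_norm c0) -/r ur.
(* An uncut window gives equality; a window cut at 0 leaves the surplus
   [(1 - a * r) ^+ 3 / (3 * a ^+ 2)]. *)
rewrite -subr_ge0 /c; case: (leP 0 (r - a^-1)) => h;
  first by rewrite le_eqVlt; apply/orP; left; apply/eqP; field.
have har : a * r <= 1 by rewrite -ler_pdivlMl// mulr1 -subr_le0 ltW.
rewrite (_ : _ - _ = (1 - a * r) ^+ 3 / (3 * a ^+ 2)); last by field.
by rewrite divr_ge0// ?exprn_ge0 ?subr_ge0// mulr_ge0// sqr_ge0.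
Qed.

Lemma value_ge_sqrt n u : 0 <= u <= 1 ->
  Num.sqrt (2 * n.+1%:R) * Num.sqrt u - value_defect n.+1 <= value n.+1 0 u.
Proof.
elim: n u => [|n IH] u u01; have /andP[u0 u1] := u01.
  apply: (@le_trans _ _ 0); last exact: value_ge0.
  rewrite /value_defect big_geq// mul0r addr0 mulr1 subr_le0.
  rewrite -sqrtrM// (@le_trans _ _ (Num.sqrt (2 ^+ 2)))//;
    last by rewrite sqrtr_sqr ger0_norm.
  by rewrite ler_wsqrtr//; lra.
set a := Num.sqrt (2 * n.+1%:R) in IH *.
have a0 : 0 < a by rewrite sqrtr_gt0 mulr_gt0// ltr0n.
have asq : a ^+ 2 = 2 * n.+1%:R by rewrite sqr_sqrtr// mulr_ge0.
set b := value_defect n.+1.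
pose g x := if x <= u then Num.max 0 ((1 - a * Num.sqrt u) + a * Num.sqrt x)
  else 0.
have bg : bmeas g.
  apply: bmeas_if; last exact: bmeas_cst.
  apply: bmeas_max; first exact: bmeas_cst.
  exact/bmeas_continuous/continuous_sqrt_affine.
rewrite [leRHS]valueS /bellman;
  apply: (@le_trans _ _ (umean (fun x => g x + (a * Num.sqrt u - b))));
    last first.
  apply: umean_le; [by apply: bmeasD => //;
    exact: bmeas_cst|exact/bmeas_bellman/value_nd|].
  move=> x x01; rewrite /g /vnext; have hu := IH _ u01; have hx := IH _ x01.
  rewrite -/b in hu hx.
  case: ifP => _; last by rewrite add0r le_max hu.
  by rewrite le_max; case: (leP 0 (_ + _)) => h; apply/orP; [right|left]; lra.
rewrite umeanDc//; have := mean_sqrt_gain_ge a0 u01; rewrite -/g.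
have -> : value_defect n.+2 = b + (3 * a ^+ 2)^-1.
  rewrite /b /value_defect big_nat_recr//= asq.
  have : (n.+1%:R : R) != 0 by rewrite pnatr_eq0.
  by move=> ?; field.
suff : Num.sqrt (2 * n.+2%:R) * Num.sqrt u <= a * Num.sqrt u + Num.sqrt u / a
  by lra.
rewrite [Num.sqrt u / a]mulrC -mulrDl ler_wpM2r ?sqrtr_ge0//.
have i0 : 0 < a^-1 by rewrite invr_gt0.
have s0 : 0 <= a + a^-1 by lra.
(* [(a + a^-1) ^+ 2] is [2 * n.+1 + 2] plus a square, hence at least [2 * n.+2]. *)
rewrite -[leRHS](ger0_norm s0) -sqrtr_sqr ler_wsqrtr//.
rewrite sqrrD asq mulfV ?gt_eqF// -(natr1 n.+1).
by have := sqr_ge0 a^-1; lra.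
Qed.

End value_bounds.

(** * Explicit lower bound with fourth roots *)

Section explicit_bounds.
Context {R : realType}.

Definition qrt (x : R) : R := Num.sqrt (Num.sqrt x).

Lemma qrt_ge0 x : 0 <= qrt x.
Proof. exact: sqrtr_ge0. Qed.

Lemma qrtK x : 0 <= x -> qrt x ^+ 4 = x.
Proof. by move=> x0; rewrite (exprM _ 2 2) !sqr_sqrtr// sqrtr_ge0. Qed.

Lemma ler_qrt x y : 0 <= y -> x <= y -> qrt x <= qrt y.
Proof. by move=> y0 xy; rewrite !ler_wsqrtr. Qed.

Lemma qrtM x y : 0 <= x -> qrt (x * y) = qrt x * qrt y.
Proof. by move=> x0; rewrite /qrt !sqrtrM// sqrtr_ge0. Qed.

Lemma powR_half (x : R) : 0 <= x -> x `^ (1 / 2) = Num.sqrt x.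
Proof. by move=> x0; rewrite div1r powR12_sqrt. Qed.

Lemma powR_quarter (x : R) : 0 <= x -> x `^ (1 / 4) = qrt x.
Proof.
move=> x0; rewrite (_ : 1 / 4 = 2^-1 * 2^-1); last by field.
by rewrite powRrM !powR12_sqrt ?sqrtr_ge0.
Qed.

Lemma powR_three_quarters (x : R) : 0 <= x -> x `^ (3 / 4) = qrt x ^+ 3.
Proof.
move=> x0; rewrite (_ : 3 / 4 = 1 / 4 * 3%:R); last by field.
by rewrite powRrM powR_mulrn ?powR_ge0// powR_quarter.
Qed.

(** Trades the logarithm for the shape of the allowed error term. For consecutive fourth roots
    [q <= p], the difference [p ^+ 4 - q ^+ 4 = 1] is [p - q] times at most [4 * p ^+ 3], and
    [p >= 1]. *)
Lemma harmonic_le_qrt n : \sum_(1 <= j < n.+1) (j%:R^-1 : R) <= 4 * qrt n%:R.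
Proof.
elim: n => [|n IH]; first by rewrite big_geq// mulr_ge0// qrt_ge0.
rewrite big_nat_recr//=; apply: (le_trans (lerD IH (lexx _))).
set p := qrt n.+1%:R; set q := qrt n%:R.
have p4 : p ^+ 4 = n.+1%:R by rewrite qrtK.
have q4 : q ^+ 4 = n%:R by rewrite qrtK.
have q0 : 0 <= q by exact: qrt_ge0.
have p1 : 1 <= p.
  rewrite (_ : 1 = qrt 1); last by rewrite /qrt !sqrtr1.
  by rewrite ler_qrt// ler1n.
have qp : q <= p by rewrite ler_qrt// ler_nat.
have pn : 0 < p ^+ 4 by rewrite exprn_gt0// (lt_le_trans ltr01).
rewrite -lerBrDl -p4 -(ler_pM2r pn) mulVf ?gt_eqF//.
have : p ^+ 4 - q ^+ 4 = 1 by rewrite p4 q4 -natr1; ring.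
rewrite (_ : p ^+ 4 - q ^+ 4 = (p - q) * (p ^+ 3 + p ^+ 2 * q + p * q ^+ 2 + q
  ^+ 3)); last by ring.
move=> E; rewrite -[leLHS]E [leRHS](_ : _ = (p - q) * (4 * p ^+ 4));
  last by ring.
rewrite ler_wpM2l ?subr_ge0//.
have p0 : 0 <= p by lra.
have h1 : p ^+ 2 * q <= p ^+ 3 by rewrite [leRHS]exprSr ler_wpM2l ?sqr_ge0.
have h2 : p * q ^+ 2 <= p ^+ 3 by rewrite [leRHS]exprS ler_wpM2l// ler_sqr.
have h3 : q ^+ 3 <= p ^+ 3 by rewrite lerXn2r.
have h4 : p ^+ 3 <= p ^+ 4 by rewrite [leRHS]exprS ler_peMl// exprn_ge0.
lra.
Qed.

Lemma value_ge_explicit m :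
  Num.sqrt (2 * m%:R) - 2 - 2 / 3 * qrt m%:R <= value m 0 1 :> R.
Proof.
case: m => [|m].
  rewrite mulr0 sqrtr0 /value; have := qrt_ge0 (0 : R); lra.
have := @value_ge_sqrt R m 1; rewrite ler01 lexx sqrtr1 mulr1 => /(_ isT).
rewrite /value_defect; have := harmonic_le_qrt m.
have : qrt m%:R <= qrt m.+1%:R :> R by rewrite ler_qrt// ler_nat.
lra.
Qed.

(** Of the constant [4 * d.+1 + 1], each of the [d.+1] blocks takes 2 for the defect and 2 for
    rounding its length down; the last 1 makes the inequality strict. *)
Lemma value_gt_explicit n d (c : R) : c = 2 * d.+1%:R ->
  c `^ (1 / 2) * n%:R `^ (1 / 2)
    - c `^ (3 / 4) * (pi / 3) `^ (1 / 2) * n%:R `^ (1 / 4) - (4 * d.+1%:R + 1)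
  < value n d 1.
Proof.
move=> cE; have c0 : 0 <= c by rewrite cE mulr_ge0.
have pi2 := pi_ge2 R.
have pi0 : 0 <= pi / 3 :> R by lra.
rewrite !powR_half// powR_quarter// powR_three_quarters//.
set D : R := d.+1%:R in cE *; have D1 : 1 <= D by rewrite ler1n.
have D0 : 0 <= D by [].
pose m := (n %/ d.+1)%N; have mn : (d.+1 * m <= n)%N by rewrite mulnC
  leq_trunc_div.
have := @value_ge_blocks R _ _ _ mn; rewrite -/D => h1.
have h2 := value_ge_explicit m.
have h3 : D * (Num.sqrt (2 * m%:R) - 2 - 2 / 3 * qrt m%:R) <= value n d 1.
  by apply: le_trans h1; rewrite ler_wpM2l.
set sm := Num.sqrt _ in h3; set qm := qrt _ in h3.
have mnR : D * m%:R <= n%:R by rewrite -natrM ler_nat.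
have nmR : n%:R <= D * (m%:R + 1).
  by rewrite natr1 -natrM ler_nat ltnW// mulnC ltn_ceil.
have sm0 : 0 <= sm by exact: sqrtr_ge0.
(* Rounding [n / d.+1] down to [m] costs at most 2 per block. *)
have sc : Num.sqrt c * Num.sqrt n%:R <= D * (sm + 2).
  have k0 : 0 <= D * (sm + 2) by rewrite mulr_ge0// addr_ge0.
  rewrite -[leRHS](ger0_norm k0) -sqrtr_sqr -sqrtrM// ler_wsqrtr//.
  rewrite exprMn sqrrD /sm sqr_sqrtr ?mulr_ge0// -/sm.
  apply: (@le_trans _ _ (c * (D * (m%:R + 1)))); first by rewrite ler_wpM2l.
  rewrite cE -subr_ge0 (_ : _ - _ = D ^+ 2 * (4 * sm + 2)); last by ring.
  by rewrite mulr_ge0 ?sqr_ge0// addr_ge0// mulr_ge0.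
have qD0 := qrt_ge0 D.
have qn : qrt D * qm <= qrt n%:R by rewrite -qrtM// ler_qrt.
have D4 : D = qrt D ^+ 4 by rewrite qrtK.
have dq : D * qm <= qrt D ^+ 3 * qrt n%:R.
  by rewrite {1}D4 exprSr -mulrA ler_wpM2l// exprn_ge0.
(* The coefficient of the theorem leaves room: [4 / 9 <= pi / 3] already follows from [pi >= 2]. *)
have sp : 2 / 3 <= Num.sqrt (pi / 3) :> R.
  rewrite (_ : 2 / 3 = Num.sqrt ((2 / 3) ^+ 2));
    last by rewrite sqrtr_sqr ger0_norm.
  by rewrite ler_wsqrtr//; lra.
have qc : qrt D ^+ 3 <= qrt c ^+ 3.
  by rewrite lerXn2r ?nnegrE ?qrt_ge0// ler_qrt// cE; lra.
have t1 : qrt D ^+ 3 * (2 / 3) <= qrt c ^+ 3 * Num.sqrt (pi / 3).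
  by rewrite ler_pM// exprn_ge0.
have := qrt_ge0 (n%:R : R) => qn0.
have t2 := ler_wpM2r qn0 t1.
have e1 : D * (sm - 2 - 2 / 3 * qm) = D * (sm + 2) - 4 * D - 2 / 3 * (D * qm)
  by ring.
have e2 : qrt D ^+ 3 * (2 / 3) * qrt n%:R = 2 / 3 * (qrt D ^+ 3 * qrt n%:R) by
  ring.
lra.
Qed.

End explicit_bounds.

(** * Counting turns greedily *)

Section greedy_turn_counting.
Context {R : realType}.
Implicit Types (s b : seq R) (bs : seq (seq R)) (st : nat * R).

(* A state (r, l) records the number r of turns made and the last value l. *)
Definition keeps st x : bool := if odd st.1 then x <= st.2 else st.2 <= x.

Definition step st x : nat * R := (if keeps st x then st.1 else st.1.+1, x).

Lemma step_le st x : (st.1 <= (step st x).1 <= st.1.+1)%N.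
Proof. by rewrite /step; case: ifP => _ /=; rewrite leqnSn leqnn. Qed.

Lemma block_orderedP (j : nat) x y b :
  block_ordered j [:: x, y & b] = keeps (j, x) y && block_ordered j (y :: b).
Proof. by rewrite /block_ordered /keeps/=; case: odd. Qed.

(** A count below the block number can afford a turn; once the two agree, so do the directions, and
    the block is followed without a turn. *)
Lemma block_run (j : nat) st b : (st.1 <= j)%N -> block_ordered j (st.2 :: b) ->
  ((foldl step st b).1 <= j)%N.
Proof.
elim: b st => //= x b IH [r l] /= rj; rewrite block_orderedP => /andP[k o].
apply: IH => //; rewrite /step/=.
case: (ltngtP r j) rj => // [rj _|rj _]; first by case: ifP => // _;
  exact: ltnW.
by rewrite rj k.
Qed.

(** Only the first entry of a block can push the count beyond the previous block number, and by one
    at most. *)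
Lemma blocks_run (j : nat) st bs : (st.1 <= j)%N -> [::] \notin bs ->
  (forall r, (r < size bs)%N -> block_ordered (j.+1 + r) (nth [::] bs r)) ->
  ((foldl step st (flatten bs)).1 <= j + size bs)%N.
Proof.
elim: bs j st => [|b bs IH] j st; first by rewrite addn0.
rewrite inE negb_or => rj /andP[b0 bs0] ord /=; rewrite foldl_cat addnS -addSn.
apply: IH => //; last by move=> r rs; have := ord r.+1 rs; rewrite addnS.
case: b b0 {bs0} ord => // x b _ /(_ 0%N isT); rewrite addn0 /= => o.
apply: block_run => //=; case: ifP => _ //; exact: leqW.
Qed.

(** Turning only when forced never uses more turns than a given decomposition. The initial state has
    the fictitious last value 0, so nonnegative entries start the first block without a turn. *)
Lemma dmodal_run d s : all (>= 0) s -> dmodal d s ->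
  ((foldl step (0%N, 0%R) s).1 <= d)%N.
Proof.
move=> s0 [bs [sE szbs bs0 ord]]; rewrite sE in s0 *; clear s sE.
case: bs s0 szbs bs0 ord => //= b bs; rewrite all_cat ltnS inE negb_or.
move=> /andP[ab _] sz /andP[b0 bs0] ord; rewrite foldl_cat.
apply: leq_trans sz; rewrite -[leqRHS]add0n; apply: blocks_run => //;
  last first.
  by move=> r; exact: (ord r.+1).
case: b b0 ab {bs0} ord => // x b _ /= /andP[x0 _] /(_ 0%N isT) o.
by apply: block_run => //=; rewrite /keeps/= x0.
Qed.

Lemma dmodal_map d s (f : R -> R) : {homo f : x y / x <= y} ->
  dmodal d s -> dmodal d (map f s).
Proof.
move=> fnd [bs [-> szbs bs0 ord]]; exists (map (map f) bs); split.
- by rewrite map_flatten.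
- by rewrite size_map.
- by apply: contra bs0 => /mapP[[|//] h _].
- rewrite size_map => r rs; rewrite (nth_map [::])//.
  move: (ord r rs); rewrite /block_ordered; case: odd;
    apply: homo_sorted => x y; exact: fnd.
Qed.

(** Invariant for the converse of [dmodal_run], kept along the optimal policy: [r] closed blocks
    followed by the current one, which ends in [l]. *)
Definition modal_with_last (r : nat) s l : Prop :=
  exists bs b, [/\ s = flatten (rcons bs (rcons b l)), size bs = r,
    [::] \notin bs, forall i, (i < r)%N -> block_ordered i (nth [::] bs i) &
    block_ordered r (rcons b l)].

Lemma modal_start x : modal_with_last 0 [:: x] x.
Proof. by exists [::], [::]; split. Qed.

Lemma modal_keep r s l x : modal_with_last r s l -> keeps (r, l) x ->
  modal_with_last r (rcons s x) x.
Proof.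
move=> [bs [b [-> sz bs0 ord o]]] k; exists bs, (rcons b l); split => //.
  by rewrite !flatten_rcons rcons_cat.
move: o k; rewrite /block_ordered /keeps/=.
by case: odd => o k; case: b o => [|y b] /= o; rewrite ?k//;
  rewrite rcons_path o last_rcons.
Qed.

Lemma modal_turn r s l x : modal_with_last r s l ->
  modal_with_last r.+1 (rcons s x) x.
Proof.
move=> [bs [b [-> sz bs0 ord o]]]; exists (rcons bs (rcons b l)), [::];
  split => //.
- by rewrite [in RHS]flatten_rcons cats1.
- by rewrite size_rcons sz.
- by rewrite mem_rcons inE negb_or bs0; case: b {o}.
- move=> i; rewrite ltnS nth_rcons sz leq_eqVlt => /predU1P[->|ir].
    by rewrite ltnn eqxx.
  by rewrite ir ord.
- by rewrite /block_ordered; case: odd.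
Qed.

Lemma modal_dmodal d r s l : (r <= d)%N -> modal_with_last r s l -> dmodal d s.
Proof.
move=> rd [bs [b [-> sz bs0 ord o]]]; exists (rcons bs (rcons b l));
  split => //.
- by rewrite size_rcons sz ltnS.
- by rewrite mem_rcons inE negb_or bs0; case: b {o}.
- move=> i; rewrite size_rcons ltnS nth_rcons sz leq_eqVlt => /predU1P[->|ir].
    by rewrite ltnn eqxx.
  by rewrite ir ord.
Qed.

End greedy_turn_counting.

(** * The observations *)

Section observations.
Context (dT : measure_display) (T : measurableType dT) (R : realType).
Variables (P : probability T R) (X : nat -> {RV P >-> R}) (F : R -> R).
Hypothesis indepX : mutually_independent X.
Hypothesis contF : continuous F.
Hypothesis cdfX : forall (i : nat) (x : R), cdf (X i) x = (F x)%:E.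

Definition uniformized (i : nat) (w : T) : R := F (X i w).

Let cdfE i x : P (X i @^-1` `]-oo, x]) = (F x)%:E.
Proof. exact: (cdfX i x). Qed.

Lemma cdf_homo : {homo F : x y / x <= y}.
Proof.
move=> x y xy; rewrite -lee_fin -!(cdfX 0); exact: cdf_nondecreasing.
Qed.

Lemma cdf_itv01 x : 0 <= F x <= 1.
Proof. by rewrite -!lee_fin -!(cdfX 0) cdf_ge0 cdf_le1. Qed.

(** The limits of [F] at both infinities bracket [z], and continuity fills in. The endpoints are
    excluded because [F] need not attain 0 or 1. *)
Lemma cdf_surj z : 0 < z < 1 -> exists a, F a = z.
Proof.
move=> /andP[z0 z1].
have [a Fa] : exists a, F a <= z.
  have := cvg_cdfNy0 (X 0); rewrite (_ : cdf (X 0) = EFin \o F);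
    last exact/funext.
  move=> /fine_cvg/cvgrPdist_lt/(_ z z0) h.
  near (ninfty_nbhs R) => a; exists a; apply: ltW.
  have : `|0 - (F a)| < z by near: a; exact: h.
  by rewrite sub0r normrN; apply: le_lt_trans; exact: ler_norm.
have [b Fb] : exists b, z <= F b.
  have z10 : 0 < 1 - z by rewrite subr_gt0.
  have := cvg_cdfy1 (X 0); rewrite (_ : cdf (X 0) = EFin \o F);
    last exact/funext.
  move=> /fine_cvg/cvgrPdist_lt/(_ _ z10) h.
  near (pinfty_nbhs R) => b; exists b; apply: ltW.
  have : `|1 - (F b)| < 1 - z by near: b; exact: h.
  by move=> /(le_lt_trans (ler_norm _)); lra.
have [ab|/ltW ba] := leP a b.
  have [||c _ <-] := @IVT _ F a b z ab; last by exists c.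
    exact: continuous_subspaceT.
  by rewrite ge_min Fa le_max Fb orbT.
(* Here [b <= a], so monotonicity squeezes [F a] between [z] and [z]. *)
exists a; apply/eqP; rewrite eq_le Fa (le_trans Fb)// cdf_homo.
Unshelve. all: by end_near. Qed.

Lemma measurable_cdf : measurable_fun setT F.
Proof. exact: continuous_measurable_fun. Qed.

Lemma measurable_uniformized i : measurable_fun setT (uniformized i).
Proof. exact: measurableT_comp measurable_cdf _. Qed.

(** As [F] may be flat, the event [F (X i) < y] is only sandwiched: inside [X i <= a] when
    [F a = y], and around [X i <= a] when [F a = z] for any [z < y]. *)
Lemma uniformized_ray i y : P (uniformized i @^-1` `[y, +oo[) =
  uniform_prob (@ltr01 R) `[y, +oo[.
Proof.
rewrite uniform_prob_ray; case: ifPn => [y0|].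
  rewrite (_ : _ @^-1` _ = setT) ?probability_setT//.
  apply/seteqP; split => // w _ /=; rewrite in_itv/= andbT (le_trans y0)//.
  by have /andP[] := cdf_itv01 (X i w).
rewrite -ltNge => y0; case: ifPn => [y1|]; last first.
  rewrite -ltNge => y1; rewrite (_ : _ @^-1` _ = set0) ?measure0//.
  apply/seteqP; split => // w /=; rewrite in_itv/= andbT /uniformized => yF.
  by have /andP[_] := cdf_itv01 (X i w); rewrite leNgt (lt_le_trans y1 yF).
pose E := uniformized i @^-1` `]-oo, y[.
have mE : measurable E.
  by rewrite -[E]setTI; apply: measurable_uniformized.
have -> : uniformized i @^-1` `[y, +oo[ = ~` E.
  by rewrite /E preimage_setC setCitvl.
rewrite probability_setC//.
have fE : P E \is a fin_num by exact: fin_num_measure.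
rewrite -(fineK fE) -EFinB; congr (_%:E); congr (_ - _).
have mX x : measurable (X i @^-1` `]-oo, x]).
  by rewrite -[X in measurable X]setTI; exact: measurable_funP.
apply/eqP; rewrite eq_le; apply/andP; split.
  have [y1'|y1'] := ltP y 1; last first.
    by rewrite (le_trans _ y1')// -lee_fin fineK// probability_le1.
  have [|a Fa] := @cdf_surj y; first by rewrite y0.
  rewrite -lee_fin fineK// -Fa -(cdfE i a); apply: le_measure; rewrite ?inE//.
  move=> w; rewrite /E /= !in_itv/= -Fa /uniformized => h.
  by rewrite leNgt; apply/negP => /ltW/cdf_homo; rewrite leNgt h.
apply/ler_addgt0Pr => e e0; rewrite -lerBlDr.
have : y - e < y by rewrite ltrBlDr ltrDl.
move: (y - e) => z zy; have [z0|z0] := leP z 0.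
  by rewrite (le_trans z0)// fine_ge0.
have [|a Fa] := @cdf_surj z; first by rewrite z0 (lt_le_trans zy).
rewrite -lee_fin fineK// -Fa -(cdfE i a); apply: le_measure; rewrite ?inE//.
move=> w; rewrite /E /= !in_itv/= /uniformized => /cdf_homo.
by rewrite Fa => h; exact: le_lt_trans zy.
Qed.

Lemma uniformized_law i B : measurable B ->
  P (uniformized i @^-1` B) = uniform_prob (@ltr01 R) B.
Proof. by apply: uniform_lawP => [|y];
  [exact: measurable_uniformized|exact: uniformized_ray]. Qed.

(** The strict past of time [i], trivial at 0; [history i.+1] is the natural filtration at [i]. *)
Definition history (i : nat) : set (set T) :=
  <<s \bigcup_(j in [set j | (j < i)%N]) g_sigma_algebra_preimage (X j) >>.

Lemma history_measurable i : history i `<=` measurable.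
Proof.
apply: smallest_sub; first exact: sigma_algebra_measurable.
by move=> A [j _ [B mB <-]]; exact: measurable_funP.
Qed.

Lemma history_le i j : (i <= j)%N -> history i `<=` history j.
Proof.
move=> ij; apply: sub_smallest2r; first exact: smallest_sigma_algebra.
by move=> A [k /= ki h]; exists k => //=; exact: leq_trans ij.
Qed.

(** As functions of [E] both sides are finite measures; they agree on the cylinders over the times
    before [i], which are stable under intersection and generate the history. *)
Lemma history_indep i E B : history i E -> measurable B ->
  P (E `&` X i @^-1` B) = (P E * P (X i @^-1` B))%E.
Proof.
move=> hE mB.
pose cyl (A : nat -> set R) := \bigcap_(j in [set` iota 0 i]) (X j @^-1` A j).
pose G := [set cyl A | A in [set A | forall j, measurable (A j)]].
have mXB : measurable (X i @^-1` B).
  by rewrite -[X in measurable X]setTI; exact: measurable_funP.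
have Gm : G `<=` measurable.
  move=> _ [A mA <-]; apply: fin_bigcap_measurable => // j _.
  by rewrite -[X in measurable X]setTI; exact: measurable_funP.
have GT : G setT.
  exists (fun=> setT) => //; rewrite /cyl -subTset => w _ j _ //.
have fB : P (X i @^-1` B) \is a fin_num by exact: fin_num_measure.
pose r : {nonneg R} := NngNum (fine_ge0 (measure_ge0 P (X i @^-1` B))).
suff -> : P (E `&` X i @^-1` B) = mscale r P E.
  by rewrite [RHS]muleC -[in RHS](fineK fB).
have := @g_sigma_algebra_measure_unique _ R T G Gm (fun=> setT) _ _
  (mrestr P mXB) (mscale r P) _ _ _ E; apply => //.
- by rewrite bigcup_const.
- move=> _ _ [A mA <-] [A' mA' <-]; exists (fun j => A j `&` A' j).
    by move=> j; exact: measurableI.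
  by rewrite /cyl -bigcapI; apply: eq_bigcapr => j _; rewrite preimage_setI.
- move=> _ [A mA <-]; transitivity (P (X i @^-1` B) * P (cyl A))%E;
  last by rewrite -[in LHS](fineK fB).
  rewrite /= /mrestr.
  (* Placing [B] at coordinate [i] turns the intersection into one cylinder over [iota 0 i.+1]. *)
  have mA' j : measurable ((fun j => if j == i then B else A j) j).
    by case: ifP.
  rewrite (indepX (iota_uniq 0 i) mA) [RHS]muleC.
  have iE : iota 0 i.+1 = iota 0 i ++ [:: i] by rewrite -addn1 iotaD.
  transitivity (\prod_(j <- iota 0 i.+1) P (X j @^-1` (if j == i then B else A
    j)))%E.
    rewrite -(indepX (iota_uniq 0 i.+1) mA'); congr (P _); apply/seteqP;
      split => w.
      move=> [h hB] j jS; have : j \in iota 0 i.+1 := jS.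
      rewrite iE mem_cat inE => /orP[ji|/eqP->]; last by rewrite eqxx.
      case: eqP => [jE|_]; last exact: h.
      by rewrite jE in ji *.
    move=> h; split.
      move=> j /= ji; have jS : j \in iota 0 i.+1 by rewrite iE mem_cat ji.
      have := h j jS.
      by case: eqP => // jE; move: ji; rewrite jE mem_iota add0n ltnn andbF.
    have iS : i \in iota 0 i.+1 by rewrite iE mem_cat inE eqxx orbT.
    by have := h i iS; rewrite eqxx.
  rewrite iE big_cat/= big_seq1 eqxx; congr (_ * _)%E.
  apply: eq_big_seq => j; rewrite mem_iota add0n => /andP[_ ji].
  by rewrite ltn_eqF.
- by move=> _; rewrite /= /mrestr setTI -ge0_fin_numE.
- apply: sub_smallest2r hE; first exact: smallest_sigma_algebra.
  move=> A [j /= ji [C mC <-]]; rewrite setTI.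
  exists (fun k => if k == j then C else setT); first by move=> k; case: ifP.
  apply/seteqP; split => w.
    by move=> /(_ j); rewrite /= mem_iota eqxx; apply.
  by move=> Cw k _ /=; case: eqP => [->|].
Qed.

Lemma uniformized_history_indep i E B : history i E -> measurable B ->
  P (E `&` uniformized i @^-1` B) = (P E * uniform_prob (@ltr01 R) B)%E.
Proof.
move=> hE mB; rewrite -(uniformized_law i mB);
  apply: (history_indep (B := F @^-1` B)) => //.
by rewrite -[X in measurable X]setTI; exact: measurable_cdf.
Qed.

Lemma uniformized_history i B : measurable B ->
  history i.+1 (uniformized i @^-1` B).
Proof.
move=> mB; apply: sub_sigma_algebra; exists i => //=.
exists (F @^-1` B); last by rewrite setTI.
by rewrite -[X in measurable X]setTI; exact: measurable_cdf.
Qed.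

(** By independence the pair has a product law, so Tonelli integrates out the new observation with
    the history frozen. *)
Lemma integral_history_uniformized (i : nat) d' (S : measurableType d') (Y : T
  -> S)
    (g : S * R -> \bar R) :
  (forall B, measurable B -> history i (Y @^-1` B)) ->
  measurable_fun setT g -> (forall z, 0 <= g z)%E ->
  (\int[P]_w g (Y w, uniformized i w) =
   \int[P]_w \int[lebesgue_measure]_(x in `[0%R, 1%R]) g (Y w, x))%E.
Proof.
move=> hY mg g0.
have mY : measurable_fun setT Y.
  by move=> _ B mB; rewrite setTI; apply: history_measurable; exact: hY.
have mYU : measurable_fun setT (fun w => (Y w, uniformized i w)).
  by apply: measurable_fun_pair => //; exact: measurable_uniformized.
pose Ym : {mfun T >-> S} :=
  HB.pack Y (@isMeasurableFun.Build _ _ T S Y mY).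
pose YU : {mfun T >-> (S * measurableTypeR R)%type} :=
  HB.pack (fun w => (Y w, uniformized i w))
    (@isMeasurableFun.Build _ _ T (S * measurableTypeR R)%type _ mYU).
transitivity (\int[distribution P YU]_z g z)%E.
  by rewrite (@ge0_integral_pushforward _ _ _ (S * measurableTypeR R)%type _ _
    mYU P setT g).
transitivity (\int[(distribution P Ym \x uniform_prob ltr01)%E]_z g z)%E.
  apply: eq_measure_integral => A mA _; apply/esym.
  apply: (@product_measure_unique _ _ _ (measurableTypeR R) _ (distribution P
    Ym) (uniform_prob ltr01)
    (distribution P YU)) => // B C mB mC.
  exact: uniformized_history_indep (hY _ mB) mC.
rewrite fubini_tonelli1// ge0_integral_pushforward//.
- apply: eq_integral => w _.
  rewrite /= /fubini_F integral_uniform//=.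
    by rewrite subr0 invr1 mul1e.
  exact: measurableT_comp mg _.
- exact: measurable_fun_fubini_tonelli_F.
- by move=> y _; exact: integral_ge0.
Qed.

End observations.

(** * The value of a state of the selection *)

Section state_value.
Context {R : realType}.
Implicit Types (st : nat * R) (n d : nat) (x : R).

Definition room st : R := if odd st.1 then st.2 else 1 - st.2.

(** A state past its last allowed turn gets the same [-2] as a forbidden turn in [vnext]. *)
Definition state_value d n st : R :=
  if (st.1 <= d)%N then value n (d - st.1) (room st) else -2.

Definition best_gain d n st x : R :=
  Num.max (state_value d n st) (1 + state_value d n (step st x)).

(** Reflecting [x] to [1 - x] in increasing blocks reduces both directions to the single recursion
    of [vnext]. *)
Lemma state_value_step d n st x : (st.1 <= d)%N ->
  state_value d n (step st x) =
  vnext (value n) (d - st.1) (room st) (if odd st.1 then x else 1 - x).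
Proof.
case: st => r l /= rd; rewrite /state_value /step /keeps /room /vnext /=.
have [kE|kE] : (d - r = 0)%N \/ exists k, (d - r = k.+1)%N.
- by case: (d - r)%N => [|k]; [left|right; exists k].
- have rd' : (r < d)%N = false.
    by apply/negbTE; rewrite -ltnNge ltnS -subn_eq0 kE.
  rewrite kE; case: (boolP (odd r)) => or /=.
    by case: (x <= l); rewrite /= ?rd ?rd' ?kE ?or.
  by rewrite lerD2l lerN2; case: (l <= x); rewrite /= ?rd ?rd' ?kE ?(negbTE or).
case: kE => k kE; have rd' : (r < d)%N by rewrite -subn_gt0 kE.
have kE' : (d - r.+1 = k)%N by rewrite subnS kE.
rewrite kE; case: (boolP (odd r)) => or /=.
  by case: (x <= l); rewrite /= ?rd ?rd' ?kE ?kE' ?or.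
by rewrite lerD2l lerN2; case: (l <= x);
  rewrite /= ?rd ?rd' ?kE ?kE' ?(negbTE or)// subKr.
Qed.

Lemma state_value_alive d n st : (st.1 <= d)%N ->
  state_value d n st = value n (d - st.1) (room st).
Proof. by rewrite /state_value => ->. Qed.

Lemma best_gainE d n st x : (st.1 <= d)%N ->
  best_gain d n st x =
  Num.max (value n (d - st.1) (room st)) (1 +
    vnext (value n) (d - st.1) (room st) (if odd st.1 then x else 1 - x)).
Proof. by move=> rd; rewrite /best_gain state_value_step// state_value_alive.
Qed.

Lemma umean_best_gain d n st : (st.1 <= d)%N ->
  umean (best_gain d n st) = state_value d n.+1 st.
Proof.
move=> rd; rewrite state_value_alive// valueS /bellman.
set h := fun x => _.
have bh : bmeas h by exact/bmeas_bellman/value_nd.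
case: (boolP (odd st.1)) => o; last first.
  rewrite -(umean_onem bh); apply: eq_umean => x _.
  by rewrite best_gainE// (negbTE o).
by apply: eq_umean => x _; rewrite best_gainE// o.
Qed.

Lemma state_value_ge0 d n st : (st.1 <= d)%N -> 0 <= state_value d n st.
Proof. by move=> rd; rewrite state_value_alive// value_ge0. Qed.

Lemma state_value_norm d n st : `|state_value d n st| <= n%:R + 2.
Proof.
rewrite /state_value; case: ifP => _; last first.
  by rewrite normrN ger0_norm// lerDr.
by rewrite ger0_norm ?value_ge0// (le_trans (value_le _ _ _))// lerDl.
Qed.

Lemma state_value0 d st : (st.1 <= d)%N -> state_value d 0 st = 0.
Proof. by move=> rd; rewrite state_value_alive. Qed.

(** On each side of [u] the value after acceptance is injective in [x] by [value_lt], or constantly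
    [n], or [-2]; the last two cases admit no tie. *)
Lemma vnext_tie n k u x y : 0 <= x <= 1 -> 0 <= y <= 1 -> (x <= u) = (y <= u) ->
  value n k u = 1 + vnext (value n) k u x ->
  value n k u = 1 + vnext (value n) k u y -> x = y :> R.
Proof.
have inj k' z t : (k' < n)%N -> 0 <= z <= 1 -> 0 <= t <= 1 ->
    value n k' z = value n k' t -> z = t :> R.
  move=> kn /andP[z0 z1] /andP[t0 t1] E; apply/eqP.
  rewrite eq_le; apply/andP; split; rewrite leNgt; apply/negP => h.
    by have := value_lt kn t0 h z1; rewrite E ltxx.
  by have := value_lt kn z0 h t1; rewrite E ltxx.
move=> x01 y01; rewrite /vnext => <-; case: ifP => _ Ex Ey.
  have [nk|kn] := leqP n k; last by apply: (inj k) => //; lra.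
  by move: Ex; rewrite !value_many_turns//; lra.
case: k Ex Ey => [|k] Ex Ey; first by have := value_ge0 n 0 u; lra.
have [nk|kn] := leqP n k.
  by move: Ex; rewrite !value_many_turns ?(leqW nk)//; lra.
have : 1 - x = 1 - y; last by lra.
apply: (inj k) => //; last by lra.
  by move: x01 => /andP[? ?]; apply/andP; split; lra.
by move: y01 => /andP[? ?]; apply/andP; split; lra.
Qed.

(** At most three points: the last selected value and one tie on each side of the room. *)
Lemma tie_null d n st : (st.1 <= d)%N ->
  (@lebesgue_measure R).-negligible
   (`[0, 1] `&` [set x | x = st.2 \/ state_value d n st = 1 + state_value d n
     (step st x)]).
Proof.
move=> rd; pose z x : R := if odd st.1 then x else 1 - x.
have zi x y : z x = z y -> x = y by rewrite /z; case: ifP => _; lra.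
have z01 x : 0 <= x <= 1 -> 0 <= z x <= 1.
  by rewrite /z; case: ifP => // _ /andP[? ?]; apply/andP; split; lra.
pose A b := [set x | [/\ 0 <= x <= 1, (z x <= room st) = b &
  state_value d n st = 1 + state_value d n (step st x)]].
have A1 b : exists a, A b `<=` [set a].
  have [->|/set0P[a Aa]] := eqVneq (A b) set0; first by exists 0;
    exact: sub0set.
  exists a => x Ax; apply: zi.
  case: Aa Ax => a01 az + [x01 xz];
    rewrite !state_value_step// state_value_alive//.
  by move=> ? ?; apply: (@vnext_tie n (d - st.1) (room st));
    rewrite ?z01 ?az ?xz.
have [a Aa] := A1 true; have [b Ab] := A1 false.
have N (c : R) : (@lebesgue_measure R).-negligible [set c].
  by exists [set c]; split => //; exact: lebesgue_measure_set1.
apply: negligibleS (negligibleU (N st.2) (negligibleU (N a) (N b))).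
move=> x [/=]; rewrite in_itv/= => x01 [->|xt]; first by left.
right; case: (boolP (z x <= room st)) => h; [left; apply: Aa|right; apply: Ab];
  split => //; exact/negbTE.
Qed.

Lemma measurable_nat_slices (d1 d2 : measure_display) (S : measurableType d1)
  (S' : measurableType d2)
    (f : nat -> S -> S') : (forall k, measurable_fun setT (f k)) ->
  measurable_fun setT (fun p : nat * S => f p.1 p.2).
Proof.
move=> mf _ B mB; rewrite setTI.
rewrite (_ : _ @^-1` B = \bigcup_k ([set k] `*` (f k @^-1` B))); last first.
  apply/seteqP; split => [[k s] /= h|[k s] [j _ [/= -> h]]] //.
  by exists k => //; split.
apply: bigcupT_measurable => k; apply: measurableX => //.
by rewrite -[X in measurable X]setTI; exact: mf.
Qed.

Lemma measurable_state_value d n : measurable_fun setT (state_value d n).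
Proof.
pose f (k : nat) (l : R) := state_value d n (k, l).
rewrite (_ : state_value d n = fun p => f p.1 p.2); last by apply/funext => -[].
apply: measurable_nat_slices => k; rewrite /f /state_value /=.
case: (k <= d)%N => //.
have mv : measurable_fun setT (value n (d - k) : R -> R).
  by apply: nondecreasing_measurable => // x y; exact: value_nd.
rewrite /room/=; case: (odd k) => //.
by apply: (measurableT_comp mv); exact: measurable_funB.
Qed.

Lemma measurable_step : measurable_fun setT (fun z : (nat * R) * R =>
  step z.1 z.2).
Proof.
have m1 : measurable_fun setT (fun z : (nat * R) * R => z.1.1).
  exact: measurableT_comp measurable_fst measurable_fst.
have m2 : measurable_fun setT (fun z : (nat * R) * R => z.1.2).
  exact: measurableT_comp measurable_snd measurable_fst.
have m3 : measurable_fun setT (fun z : (nat * R) * R =>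
  z.2) by exact: measurable_snd.
apply: measurable_fun_pair => //=.
apply: measurable_fun_ifT => //.
  apply: measurable_fun_ifT; [|exact: measurable_fun_ler..].
  by apply: (@measurableT_comp _ _ _ _ _ _ odd).
by apply: (@measurableT_comp _ _ _ _ _ _ succn).
Qed.

Lemma measurable_best_gain d n :
  measurable_fun setT (fun z : (nat * R) * R => best_gain d n z.1 z.2).
Proof.
apply: measurable_maxr.
  exact: measurableT_comp (measurable_state_value d n) measurable_fst.
apply: measurable_funD => //.
exact: measurableT_comp (measurable_state_value d n) measurable_step.
Qed.

End state_value.

(** * Verification *)

Section bounded_expectation.
Context (dT : measure_display) (T : measurableType dT) (R : realType).
Variable P : probability T R.
Implicit Types f g : T -> R.

Definition bounded_rv f := measurable_fun setT f /\ exists M, forall w,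
  `|f w| <= M.

Lemma bounded_rv_integrable f : bounded_rv f -> P.-integrable setT (EFin \o f).
Proof.
move=> [mf [M fM]]; apply: measurable_bounded_integrable => //.
  by rewrite (le_lt_trans (probability_le1 P measurableT))// ltry.
exists M; split; first exact: num_real.
by move=> x Mx w _ /=; rewrite (le_trans (fM w))// ltW.
Qed.

Lemma bounded_rvD f g : bounded_rv f -> bounded_rv g ->
  bounded_rv (fun w => f w + g w).
Proof.
move=> [mf [M fM]] [mg [N gN]]; split; first exact: measurable_funD.
by exists (M + N) => w; rewrite (le_trans (ler_normD _ _))// lerD.
Qed.

Lemma eq_expectation_ae f g : bounded_rv f -> bounded_rv g ->
  (forall w, f w <= g w) -> \int[P]_w f w = \int[P]_w g w ->
  {ae P, forall w, f w = g w}.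
Proof.
move=> bf bg fg E.
have i_f := bounded_rv_integrable bf; have i_g := bounded_rv_integrable bg.
have mh : measurable_fun setT (fun w => (g w - f w)%:E).
  by apply/measurable_EFinP; apply: measurable_funB; [case: bg|case: bf].
have h0 : \int[P]_w (g w - f w) = 0 by rewrite RintegralB// E subrr.
have ih : P.-integrable setT (fun w => (g w - f w)%:E).
  have := integrableB measurableT i_g i_f; by apply: eq_integrable.
have : (\int[P]_w `|(g w - f w)%:E| = 0)%E.
  rewrite (eq_integral (fun w => (g w - f w)%:E)); last first.
    by move=> w _; rewrite /= ger0_norm// subr_ge0.
  have := integrable_fin_num measurableT ih => /fineK <-.
  by rewrite -/(Rintegral P setT (fun w => g w - f w)) h0.
move=> /(ae_eq_integral_abs _ measurableT mh).
apply: filterS => w /(_ I) /= [] /eqP; rewrite subr_eq0 => /eqP -> //.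
Qed.

Lemma ae_eq_expectation f g : bounded_rv f -> bounded_rv g ->
  {ae P, forall w, f w = g w} -> \int[P]_w f w = \int[P]_w g w.
Proof.
move=> [mf _] [mg _] fg; congr fine; apply: ae_eq_integral => //.
- exact/measurable_EFinP.
- exact/measurable_EFinP.
- by apply: filterS fg => w /= -> _.
Qed.

End bounded_expectation.

(** * The potential along an adapted acceptance process *)

Section acceptance_process.
Context (dT : measure_display) (T : measurableType dT) (R : realType).
Variables (P : probability T R) (X : nat -> {RV P >-> R}) (F : R -> R).
Hypothesis indepX : mutually_independent X.
Hypothesis contF : continuous F.
Hypothesis cdfX : forall (i : nat) (x : R), cdf (X i) x = (F x)%:E.
Implicit Type acc : nat -> T -> bool.

Local Notation U := (uniformized X F).

Fixpoint greedy_state acc (i : nat) (w : T) : nat * R :=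
  if i is j.+1 then
    if acc j w then step (greedy_state acc j w) (U j w) else greedy_state acc j
      w
  else (0%N, 0).

Definition accepted acc (i : nat) (w : T) : R :=
  \sum_(0 <= j < i) (acc j w)%:R.

Definition adapted acc := forall i, history X i.+1 [set w | acc i w].

Lemma acceptedS acc i w : accepted acc i.+1 w = accepted acc i w + (acc i w)%:R.
Proof. by rewrite /accepted big_nat_recr. Qed.

Let HT i := g_sigma_algebraType
  (\bigcup_(j in [set j | (j < i)%N]) g_sigma_algebra_preimage (X j)).

Lemma measurable_history_le (i j : nat) d' (S : measurableType d') (f : T ->
  S) :
  (i <= j)%N -> measurable_fun (setT : set (HT i)) f ->
  measurable_fun (setT : set (HT j)) f.
Proof.
move=> ij mf _ B mB; rewrite setTI; apply: (history_le ij).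
by have := mf measurableT B mB; rewrite setTI.
Qed.

Lemma measurable_greedy_state acc i : adapted acc ->
  measurable_fun (setT : set (HT i)) (greedy_state acc i).
Proof.
move=> ad; elim: i => [|i IH]; first exact: measurable_cst.
have mi := measurable_history_le (leqnSn i) IH.
have mU : measurable_fun (setT : set (HT i.+1)) (U i).
  by move=> _ B mB; rewrite setTI; exact: uniformized_history.
apply: measurable_fun_ifT => //.
  by apply: (measurable_fun_bool true); rewrite setTI; exact: ad.
exact: measurableT_comp measurable_step (measurable_fun_pair mi mU).
Qed.

Lemma greedy_state_history acc i : adapted acc ->
  forall B, measurable B -> history X i (greedy_state acc i @^-1` B).
Proof.
move=> ad B mB; have := @measurable_greedy_state acc i ad.
by move=> /(_ measurableT B mB); rewrite setTI.
Qed.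

Lemma measurable_greedy acc i : adapted acc ->
  measurable_fun setT (greedy_state acc i).
Proof.
move=> ad _ B mB; rewrite setTI; apply: history_measurable.
exact: greedy_state_history.
Qed.

Lemma measurable_state_observation acc i : adapted acc ->
  measurable_fun setT (fun w => (greedy_state acc i w, U i w)).
Proof.
move=> ad; apply: measurable_fun_pair; first exact: measurable_greedy.
exact: measurable_uniformized.
Qed.

Lemma bounded_accepted acc i : adapted acc -> bounded_rv (accepted acc i).
Proof.
move=> ad; elim: i => [|i IH].
  rewrite (_ : accepted acc 0 = cst 0); last by apply/funext => w;
    rewrite /accepted big_geq.
  by split; [exact: measurable_cst|exists 0 => w; rewrite normr0].
rewrite (_ : accepted _ _ = fun w => accepted acc i w + (acc i w)%:R);
  last first.
  by apply/funext => w; exact: acceptedS.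
apply: bounded_rvD => //; split.
  rewrite (_ : (fun w => _) = \1_[set w | acc i w]).
    by apply: measurable_indic; apply: history_measurable; exact: ad.
  apply/funext => w; rewrite indicE.
  by have -> : (w \in [set w | acc i w]) = acc i w by apply/idP/idP;
    rewrite inE.
by exists 1 => w; case: (acc i w); rewrite ?normr1 ?normr0.
Qed.

Variables d n : nat.

Definition potential acc i w : R :=
  accepted acc i w + state_value d (n - i) (greedy_state acc i w).

(** The next potential under the best decision at time [i]: it dominates the actual one and, by the
    Bellman equation, has the mean of the current one. *)
Definition potential_bound acc i w : R :=
  accepted acc i w + best_gain d (n - i.+1) (greedy_state acc i w) (U i w).

Definition alive acc := forall i w,
  (i <= n)%N -> ((greedy_state acc i w).1 <= d)%N.

Lemma potential_le acc i w : potential acc i.+1 w <= potential_bound acc i w.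
Proof.
rewrite /potential /potential_bound acceptedS /= /best_gain -addrA lerD2l.
by case: (acc i w); rewrite ?add0r le_max lexx ?orbT.
Qed.

Lemma bounded_potential acc i : adapted acc -> bounded_rv (potential acc i).
Proof.
move=> ad; apply: bounded_rvD; first exact: bounded_accepted.
split; last by exists ((n - i)%:R + 2) => w; exact: state_value_norm.
apply: measurableT_comp; first exact: measurable_state_value.
exact: measurable_greedy.
Qed.

Lemma bounded_best_gain acc i m : adapted acc ->
  bounded_rv (fun w => best_gain d m (greedy_state acc i w) (U i w)).
Proof.
move=> ad; split.
  have mso := measurable_state_observation i ad.
  by have := measurableT_comp (measurable_best_gain d m) mso.
exists (m%:R + 3) => w; rewrite /best_gain.
have h1 := state_value_norm d m (greedy_state acc i w).
have h2 := state_value_norm d m (step (greedy_state acc i w) (U i w)).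
move: h1 h2; rewrite !ler_norml => /andP[? ?] /andP[? ?].
rewrite le_max ge_max => *; apply/and3P; split; [apply/orP; left|..]; lra.
Qed.

Lemma bounded_potential_bound acc i : adapted acc ->
  bounded_rv (potential_bound acc i).
Proof.
by move=> ad; apply: bounded_rvD;
  [exact: bounded_accepted|exact: bounded_best_gain].
Qed.

Lemma expectation_best_gain acc i m : adapted acc ->
  (forall w, ((greedy_state acc i w).1 <= d)%N) ->
  \int[P]_w best_gain d m (greedy_state acc i w) (U i w) =
  \int[P]_w state_value d m.+1 (greedy_state acc i w).
Proof.
move=> ad al; rewrite /Rintegral; congr fine.
(* Truncation gives a function nonnegative on all states, unchanged on those with at most [d]
   turns. *)
pose g (z : (nat * R) * R) := (Num.max 0 (best_gain d m z.1 z.2))%:E.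
have gE st x : (st.1 <= d)%N -> g (st, x) = (best_gain d m st x)%:E.
  move=> rd; congr (_%:E); apply/max_idPr.
  by rewrite /best_gain le_max state_value_ge0.
transitivity (\int[P]_w g (greedy_state acc i w, U i w))%E.
  by apply: eq_integral => w _; rewrite gE.
have mg : measurable_fun setT g.
  by apply/measurable_EFinP; apply: measurable_maxr => //;
    exact: measurable_best_gain.
rewrite (integral_history_uniformized indepX contF cdfX (@greedy_state_history
  acc i ad)) => //; last first.
  by move=> z; rewrite lee_fin le_max lexx.
apply: eq_integral => w _; set st := greedy_state acc i w.
transitivity (\int[lebesgue_measure]_(x in `[0%R,
  1%R]) (best_gain d m st x)%:E)%E.
  by apply: eq_integral => x _; rewrite (gE _ _ (al w)).
rewrite -(@umean_best_gain R d m st (al w)) /umean /Rintegral fineK//.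
apply: integrable_fin_num => //; apply: bmeas_integrable; split.
  by have := measurableT_comp (measurable_best_gain d m) (measurable_pair1 st).
exists (m%:R + 3) => x _; rewrite /best_gain.
have h1 := state_value_norm d m st; have h2 := state_value_norm d m (step st x).
move: h1 h2; rewrite !ler_norml => /andP[? ?] /andP[? ?].
rewrite le_max ge_max => *; apply/and3P; split; [apply/orP; left|..]; lra.
Qed.

Lemma expectation_potential_bound acc i : adapted acc -> alive acc ->
  (i < n)%N ->
  \int[P]_w potential_bound acc i w = \int[P]_w potential acc i w.
Proof.
move=> ad al i_n; rewrite /potential_bound /potential -(subnSK i_n).
rewrite !RintegralD//; first last.
- exact/bounded_rv_integrable/bounded_best_gain.
- exact/bounded_rv_integrable/bounded_accepted.
- apply: bounded_rv_integrable; split; last by eexists => w;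
  exact: state_value_norm.
  by apply: measurableT_comp;
    [exact: measurable_state_value|exact: measurable_greedy].
- exact/bounded_rv_integrable/bounded_accepted.
by rewrite expectation_best_gain// => w; apply: al; exact: ltnW.
Qed.

Lemma expectation_potential_noninc acc i : adapted acc -> alive acc ->
  (i < n)%N ->
  \int[P]_w potential acc i.+1 w <= \int[P]_w potential acc i w.
Proof.
move=> ad al i_n; rewrite -(expectation_potential_bound ad al i_n).
apply: le_Rintegral => //.
- exact/bounded_rv_integrable/bounded_potential.
- exact/bounded_rv_integrable/bounded_potential_bound.
- by move=> w _; exact: potential_le.
Qed.

Lemma expectation_potential0 acc : \int[P]_w potential acc 0 w = value n d 1.
Proof.
under eq_Rintegral => w _ do rewrite /potential /accepted big_geq// add0r subn0
  /=
  state_value_alive// /room/= subr0 subn0.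
by rewrite Rintegral_cst//= probability_setT mulr1.
Qed.

Lemma expectation_potentialn acc : alive acc ->
  \int[P]_w potential acc n w = \int[P]_w accepted acc n w.
Proof.
move=> al; apply: eq_Rintegral => w _.
by rewrite /potential subnn state_value0 ?addr0//; exact: al.
Qed.

Lemma expectation_accepted_le acc : adapted acc -> alive acc ->
  \int[P]_w accepted acc n w <= value n d 1.
Proof.
move=> ad al; rewrite -expectation_potentialn// -(expectation_potential0 acc).
suff h i : (i <= n)%N ->
    \int[P]_w potential acc i w <= \int[P]_w potential acc 0 w by exact: h.
elim: i => // i IH i_n; apply: le_trans (IH (ltnW i_n)).
exact: expectation_potential_noninc.
Qed.

(** The mean potential is nonincreasing in time with equal ends, hence constant; a pointwise
    inequality between equal means is an almost sure equality. *)
Lemma optimal_potential acc : adapted acc -> alive acc ->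
  \int[P]_w accepted acc n w = value n d 1 ->
  forall i, (i < n)%N -> {ae P, forall w,
    potential acc i.+1 w = potential_bound acc i w}.
Proof.
move=> ad al E.
have lo k i : (i + k = n)%N -> value n d 1 <= \int[P]_w potential acc i w.
  elim: k i => [|k IH] i; first by rewrite addn0 => ->;
    rewrite expectation_potentialn// E.
  rewrite addnS -addSn => ikn; apply: le_trans (IH _ ikn) _.
  by apply: expectation_potential_noninc => //; rewrite -ikn leq_addr.
have hi i : (i <= n)%N -> \int[P]_w potential acc i w <= value n d 1.
  elim: i => [|i IH] i_n; first by rewrite expectation_potential0.
  apply: le_trans (IH (ltnW i_n)); exact: expectation_potential_noninc.
have eqv i : (i <= n)%N -> \int[P]_w potential acc i w = value n d 1.
  by move=> i_n; apply/eqP; rewrite eq_le hi// (lo (n - i)%N)// subnKC.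
move=> i i_n; apply: eq_expectation_ae => //.
- exact: bounded_potential.
- exact: bounded_potential_bound.
- by move=> w; exact: potential_le.
- by rewrite expectation_potential_bound// !eqv// ltnW.
Qed.

(** Given the history the observation is uniform, and [tie_null] bounds the bad values for each
    frozen state. *)
Lemma no_tie acc i m : adapted acc -> (forall w,
  ((greedy_state acc i w).1 <= d)%N) ->
  {ae P, forall w, U i w != (greedy_state acc i w).2 /\
     state_value d m (greedy_state acc i w) !=
     1 + state_value d m (step (greedy_state acc i w) (U i w))}.
Proof.
move=> ad al.
pose D := [set z : (nat * R) * R | z.2 = z.1.2 \/
  state_value d m z.1 = 1 + state_value d m (step z.1 z.2)].
have mS : measurable_fun setT (fun z : (nat * R) * R => state_value d m z.1).
  exact: measurableT_comp (measurable_state_value d m) measurable_fst.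
have mS' : measurable_fun setT (fun z : (nat * R) * R =>
  1 + state_value d m (step z.1 z.2)).
  apply: measurable_funD => //.
  exact: measurableT_comp (measurable_state_value d m) measurable_step.
have m2 : measurable_fun setT (fun z : (nat * R) * R => z.1.2).
  exact: measurableT_comp measurable_snd measurable_fst.
have mD : measurable D.
  apply: measurableU.
    have := measurable_fun_eqr (@measurable_snd _ _ (nat * R)%type R) m2.
    move=> /(_ measurableT [set true] I); rewrite setTI.
    by congr measurable; apply/seteqP; split => z /eqP.
  have := measurable_fun_eqr mS mS' => /(_ measurableT [set true] I).
  by rewrite setTI; congr measurable; apply/seteqP; split => z /eqP.
pose f w := (greedy_state acc i w, U i w).
have mf : measurable_fun setT f.
  exact: measurable_state_observation.
exists (f @^-1` D); split.
- by rewrite -[X in measurable X]setTI; exact: mf.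
- have -> : P (f @^-1` D) = (\int[P]_w (\1_D (f w))%:E)%E.
    rewrite (_ : (fun w => _) = EFin \o \1_(f @^-1` D)) //.
    by rewrite integral_indic// ?setIT// -[X in measurable X]setTI; exact: mf.
  rewrite (integral_history_uniformized indepX contF cdfX
    (@greedy_state_history acc i ad)
    (g := fun z => (\1_D z)%:E)) => //; last first.
    by apply/measurable_EFinP; exact: measurable_indic.
  rewrite integral0_eq// => w _.
  have mDw : measurable [set x | D (greedy_state acc i w, x)].
    rewrite -[X in measurable X]setTI.
    exact: measurable_pair1 measurableT _ mD.
  rewrite (_ : (fun x => _) = EFin \o \1_[set x | D (greedy_state acc i w,
    x)]) //.
  rewrite integral_indic// setIC.
  by apply/negligibleP; [exact: measurableI|exact: tie_null].
- move=> w /= h; apply: contrapT => nD; apply: h; split; apply/eqP => h;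
  apply: nD;
  by [left|right].
Qed.

End acceptance_process.

(** * The optimal policy *)

Section optimal_policy.
Context (dT : measure_display) (T : measurableType dT) (R : realType).
Variables (P : probability T R) (X : nat -> {RV P >-> R}) (F : R -> R).
Hypothesis indepX : mutually_independent X.
Hypothesis contF : continuous F.
Hypothesis cdfX : forall (i : nat) (x : R), cdf (X i) x = (F x)%:E.
Variables d n : nat.
Implicit Type q : policy T n.

Local Notation U := (uniformized X F).
Local Notation HT i := (g_sigma_algebraType
  (\bigcup_(j in [set j | (j < i)%N]) g_sigma_algebra_preimage (X j))).

Definition policy_acceptance (q : policy T n) (i : nat) (w : T) : bool :=
  if insub i is Some j then q j w else false.

Definition chosen (acc : nat -> T -> bool) (Y : nat -> T ->
  R) (i : nat) (w : T) :=
  [seq Y j w | j <- iota 0 i & acc j w].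

Lemma chosenS acc Y i w : chosen acc Y i.+1 w =
  if acc i w then rcons (chosen acc Y i w) (Y i w) else chosen acc Y i w.
Proof.
rewrite /chosen -addn1 iotaD filter_cat map_cat add0n /=.
by case: (acc i w); rewrite /= ?cats1 ?cats0.
Qed.

Lemma greedy_stateE acc i w :
  greedy_state X F acc i w = foldl step (0%N, 0) (chosen acc U i w).
Proof.
elim: i => //= i IH; rewrite chosenS IH.
by case: (acc i w); rewrite ?foldl_rcons.
Qed.

Lemma policy_acceptanceE q (i : 'I_n) w : policy_acceptance q i w = q i w.
Proof. by rewrite /policy_acceptance valK. Qed.

Lemma selectionE q w :
  selection X q w = chosen (policy_acceptance q) (fun j => X j) n w.
Proof.
rewrite /selection /chosen /selected_times -val_enum_ord filter_map -map_comp.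
by congr map; apply: eq_filter => i /=; rewrite policy_acceptanceE.
Qed.

Lemma selection_lengthE q w :
  selection_length R q w = accepted R (policy_acceptance q) n w.
Proof.
rewrite /selection_length /selected_times size_filter -sum1_count /accepted.
rewrite big_mkord big_enum_cond/= natr_sum [RHS](bigID (fun i : 'I_n =>
  q i w))/=.
rewrite [X in _ = _ + X]big1 ?addr0; last first.
  by move=> i /negbTE h; rewrite policy_acceptanceE h.
by apply: eq_bigr => i h; rewrite policy_acceptanceE h.
Qed.

Lemma feasible_adapted q : feasible_policies X d q ->
  adapted X (policy_acceptance q).
Proof.
move=> [hq _] i; rewrite /policy_acceptance; case: insubP => [j _ ji|_].
  by rewrite -ji; exact: hq.
rewrite (_ : [set w | _] = set0); last by apply/seteqP; split.
by have [] := smallest_sigma_algebra setT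
  (\bigcup_(j in [set j | (j < i.+1)%N]) g_sigma_algebra_preimage (X j)).
Qed.

Lemma greedy_state_le acc i j w : (i <= j)%N ->
  ((greedy_state X F acc i w).1 <= (greedy_state X F acc j w).1)%N.
Proof.
move=> /subnKC <-; elim: (j - i)%N => [|k IH]; first by rewrite addn0.
rewrite addnS /=; case: (acc _ w) => //; apply: leq_trans IH _.
by case/andP: (step_le (greedy_state X F acc (i + k) w) (U (i + k) w)).
Qed.

(** Since [F] is nondecreasing, the images of the selected values stay d-modal; [dmodal_run] bounds
    the final count, which dominates all earlier ones. *)
Lemma feasible_alive q : feasible_policies X d q ->
  alive X F d n (policy_acceptance q).
Proof.
move=> [_ hd] i w i_n; apply: leq_trans (greedy_state_le _ _ i_n) _.
have := dmodal_map (cdf_homo cdfX) (hd w); rewrite selectionE.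
rewrite greedy_stateE /chosen -map_comp; apply: dmodal_run.
by apply/allP => x /mapP[j _ ->]; have /andP[] := cdf_itv01 cdfX (X j w).
Qed.

Lemma feasible_expectation q : feasible_policies X d q ->
  'E_P[selection_length R q]%E =
  (\int[P]_w accepted R (policy_acceptance q) n w)%:E.
Proof.
move=> fq; rewrite unlock /Rintegral fineK.
  by apply: eq_integral => w _; rewrite selection_lengthE.
apply: integrable_fin_num => //; apply: bounded_rv_integrable.
exact: bounded_accepted (feasible_adapted fq).
Qed.

Lemma feasible_expectation_le q : feasible_policies X d q ->
  ('E_P[selection_length R q] <= (value n d 1)%:E)%E.
Proof.
move=> fq; rewrite feasible_expectation// lee_fin.
exact: (expectation_accepted_le indepX contF cdfX (feasible_adapted fq)
  (feasible_alive fq)).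
Qed.

(* Ties with the last selected value are rejected so that each selection which
   does not turn is strictly monotone for F, hence for the values themselves. *)
Definition optimal_rule (i : nat) (st : nat * R) (x : R) : bool :=
  (x != st.2) &&
  (state_value d (n - i.+1) st < 1 + state_value d (n - i.+1) (step st x)).

(** The recursion runs on states because acceptance is defined from them; it agrees with
    [greedy_state] afterwards. *)
Fixpoint optimal_state (i : nat) (w : T) : nat * R :=
  if i is j.+1 then
    if optimal_rule j (optimal_state j w) (U j w)
    then step (optimal_state j w) (U j w) else optimal_state j w
  else (0%N, 0).

Definition optimal_acceptance (i : nat) (w : T) : bool :=
  optimal_rule i (optimal_state i w) (U i w).

Definition optimal_policy : policy T n := fun i => optimal_acceptance i.

Lemma greedy_state_optimal i w :
  greedy_state X F optimal_acceptance i w = optimal_state i w.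
Proof. by elim: i => //= i ->. Qed.

Lemma measurable_optimal_rule i :
  measurable_fun setT (fun z : (nat * R) * R => optimal_rule i z.1 z.2).
Proof.
apply: measurable_and.
  apply: measurable_neg; apply: measurable_fun_eqr; first exact: measurable_snd.
  exact: measurableT_comp measurable_snd measurable_fst.
apply: measurable_fun_ltr.
  exact: measurableT_comp (measurable_state_value d _) measurable_fst.
apply: measurable_funD => //.
exact: measurableT_comp (measurable_state_value d _) measurable_step.
Qed.

Lemma adapted_optimal : adapted X optimal_acceptance.
Proof.
suff H : forall i, measurable_fun (setT : set (HT i.+1))
    (optimal_acceptance i).
  move=> i; have := H i measurableT [set true] I; rewrite setTI.
  by congr (history X _ _); apply/seteqP; split => w /=.
have mU i : measurable_fun (setT : set (HT i.+1)) (U i).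
  by move=> _ B mB; rewrite setTI; exact: uniformized_history.
have step1 i : measurable_fun (setT : set (HT i))
    (optimal_state i) -> measurable_fun (setT : set (HT i.+1))
    (optimal_acceptance i).
  move=> IH; have mp := measurable_fun_pair (measurable_history_le (leqnSn i)
    IH) (mU i).
  by have := measurableT_comp (measurable_optimal_rule i) mp.
move=> i; apply: (step1 i); elim: i => [|i IH]; first exact: measurable_cst.
have mp := measurable_fun_pair (measurable_history_le (leqnSn i) IH) (mU i).
apply: measurable_fun_ifT => //.
- exact: step1.
- by have := measurableT_comp measurable_step mp.
- exact: measurable_history_le IH.
Qed.

Lemma optimal_state_modal i w : ((optimal_state i w).1 <= d)%N /\
  (chosen optimal_acceptance (fun j =>
    X j) i w = [::] /\ optimal_state i w = (0%N, 0) \/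
   exists2 l, F l = (optimal_state i w).2 &
     modal_with_last (optimal_state i w).1
       (chosen optimal_acceptance (fun j => X j) i w) l).
Proof.
elim: i => [|i [rd IH]]; first by split => //; left.
rewrite chosenS [optimal_state i.+1 w]/= -/(optimal_acceptance i w).
have [|_] := boolP (optimal_acceptance i w); last by split.
rewrite /optimal_acceptance; move: (optimal_state i w) rd IH => st rd IH.
move=> /andP[xl gain].
have rd' : ((step st (U i w)).1 <= d)%N.
  (* A forbidden turn would offer [1 - 2], below the nonnegative value of rejection. *)
  move: gain; rewrite /state_value rd; case: ifP => // _.
  by have := value_ge0 (n - i.+1) (d - st.1) (room st); lra.
split=> //; right; exists (X i w) => //.
case: IH xl {gain rd rd'} => [[-> ->] _|[l Fl mod] xl].
  rewrite /step /keeps /=; case/andP: (cdf_itv01 cdfX (X i w)) => -> _.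
  exact: modal_start.
rewrite /step; case: ifP => [k|_]; last exact: modal_turn mod.
apply: (modal_keep mod); move: k; rewrite /keeps /= -Fl.
case: odd => h; rewrite leNgt; apply/negP => /ltW/(cdf_homo cdfX) h'.
  by move/eqP: xl; apply; rewrite -Fl; apply/eqP; rewrite eq_le h h'.
by move/eqP: xl; apply; rewrite -Fl; apply/eqP; rewrite eq_le h h'.
Qed.

Lemma feasible_optimal_policy : feasible_policies X d optimal_policy.
Proof.
split => [i|w]; first exact: adapted_optimal.
have -> : selection X optimal_policy w =
    chosen optimal_acceptance (fun j => X j) n w.
  rewrite selectionE /chosen; congr map; apply: eq_in_filter => j.
  rewrite mem_iota add0n => /andP[_ jn].
  by rewrite (policy_acceptanceE optimal_policy (Ordinal jn)).
have [rd [[-> _]|[l _ mod]]] := optimal_state_modal n w; first by exists [::].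
exact: modal_dmodal rd mod.
Qed.

Lemma alive_optimal : alive X F d n optimal_acceptance.
Proof.
by move=> i w _; rewrite greedy_state_optimal;
  have [] := optimal_state_modal i w.
Qed.

(** The rule attains the Bellman maximum unless the last selected value recurs, an event of
    probability zero, so the mean potential is conserved. *)
Lemma expectation_optimal :
  'E_P[selection_length R optimal_policy]%E = (value n d 1)%:E.
Proof.
have ad := adapted_optimal; have al := alive_optimal.
rewrite (feasible_expectation feasible_optimal_policy); congr (_%:E).
transitivity (\int[P]_w accepted R optimal_acceptance n w).
  apply: eq_Rintegral => w _; apply: eq_big_nat => j /andP[_ jn].
  by rewrite (policy_acceptanceE optimal_policy (Ordinal jn)).
rewrite -(expectation_potentialn al) -(expectation_potential0 X F d n
  optimal_acceptance).
suff H i : (i <= n)%N -> \int[P]_w potential X F d n optimal_acceptance i w =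
    \int[P]_w potential X F d n optimal_acceptance 0 w by exact: H.
elim: i => // i IH i_n; rewrite -(IH (ltnW i_n)).
rewrite -(expectation_potential_bound indepX contF cdfX ad al i_n).
apply: ae_eq_expectation; [exact: bounded_potential|exact:
  bounded_potential_bound|].
have ali w : ((greedy_state X F optimal_acceptance i w).1 <= d)%N.
  by apply: al; exact: ltnW.
apply: filterS (no_tie indepX contF cdfX (n - i.+1) ad ali) => w /= [xl _].
rewrite /potential /potential_bound acceptedS -addrA; congr (_ + _).
rewrite /= /best_gain [in LHS]/optimal_acceptance /optimal_rule.
move: xl; rewrite greedy_state_optimal => ->/=.
by case: ltP => h; rewrite ?add0r.
Qed.

Lemma optimal_policy_optimal : optimal X d optimal_policy.
Proof.
split; first exact: feasible_optimal_policy.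
apply/eqP; rewrite eq_le; apply/andP; split.
  by apply: ereal_sup_ubound; exists optimal_policy => //;
    exact: feasible_optimal_policy.
apply: ge_ereal_sup => _ [q fq <-]; rewrite expectation_optimal.
exact: feasible_expectation_le.
Qed.

(** Optimality forces the Bellman maximum almost surely at each time, and without ties the state
    alone dictates the decision. *)
Lemma optimal_policy_unique q : optimal X d q ->
  {ae P, forall w, forall i : 'I_n, q i w = optimal_policy i w}.
Proof.
move=> [fq Eq]; have [_ Eo] := optimal_policy_optimal.
have ad := feasible_adapted fq; have al := feasible_alive fq.
set acc := policy_acceptance q in ad al.
have E : \int[P]_w accepted R acc n w = value n d 1.
  by move: Eq; rewrite -Eo expectation_optimal (feasible_expectation fq) => -[].
have H : {ae P, forall w, forall i, (i < n)%N -> acc i w =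
    optimal_rule i (greedy_state X F acc i w) (U i w)}.
  apply/ae_foralln => i.
  have [i_n|_] := boolP (i < n)%N; last exact: nearW.
  have ali w : ((greedy_state X F acc i w).1 <= d)%N by apply: al; exact: ltnW.
  apply: filterS2 (no_tie indepX contF cdfX (n - i.+1) ad ali)
    (optimal_potential indepX contF cdfX ad al E i_n) => w /= [xl tie] pot _.
  move: pot; rewrite /potential /potential_bound acceptedS -addrA.
  move=> /addrI; rewrite /= /best_gain /optimal_rule xl /=.
  case: (acc i w) => h; apply/esym.
    by rewrite lt_neqAle tie/= h le_max lexx.
  apply/negbTE; rewrite -leNgt; move: h; rewrite add0r => ->.
  by rewrite le_max lexx orbT.
apply: filterS H => w H i.
(* Equal decision rules from equal initial states keep the states equal. *)
have S j : (j <= n)%N -> greedy_state X F acc j w = optimal_state j w.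
  elim: j => // j IH jn /=; rewrite H// IH ?(ltnW jn)//.
by rewrite -policy_acceptanceE -/acc H// S// ltnW.
Qed.

End optimal_policy.

(** * From the two-sided bounds to the asymptotic equivalence *)

Section asymptotics.
Context {R : realType}.

(** With [q] the fourth root of [n], the error [K * q + C] is negligible against [c * q ^+ 2]. *)
Lemma equiv_sqrt_of_bounds (e : nat -> R) (c K C : R) : 0 < c -> 0 <= K ->
  (forall n, (0 < n)%N -> c * n%:R `^ (1 / 2) - K * n%:R `^ (1 / 4) - C < e n
     < c * n%:R `^ (1 / 2)) ->
  e ~_\oo (fun n => c * n%:R `^ (1 / 2)).
Proof.
move=> c0 K0 H; apply/eqaddoP => /= eps eps0.
near=> n; rewrite !fctE.
have n0 : (0 < n)%N by near: n; exact: nbhs_infty_gt.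
have /andP[lo hi] := H n n0.
rewrite powR_half// powR_quarter// in lo hi *.
set q := qrt n%:R in lo hi *; have q0 : 0 <= q by exact: qrt_ge0.
have sE : Num.sqrt n%:R = q ^+ 2 by rewrite sqr_sqrtr// sqrtr_ge0.
rewrite sE in lo hi *.
have q2 : 0 <= c * q ^+ 2 by rewrite mulr_ge0 ?sqr_ge0// ltW.
rewrite (ger0_norm q2) ltr0_norm ?subr_lt0//.
have qb : (K + `|C| + 1) / (eps * c) <= q.
  have hn : ((K + `|C| + 1) / (eps * c)) ^+ 4 <= n%:R.
    by near: n; exact: nbhs_infty_ger.
  have h0 : 0 <= (K + `|C| + 1) / (eps * c).
    by rewrite divr_ge0// ?mulr_ge0 ?(ltW c0) ?(ltW eps0)// !addr_ge0.
  by rewrite -(@ler_pXn2r _ 4) ?nnegrE ?qrt_ge0// qrtK.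
have q1 : 1 <= q.
  rewrite (_ : 1 = qrt 1); last by rewrite /qrt !sqrtr1.
  by rewrite ler_qrt// ler1n.
have ec : 0 < eps * c by rewrite mulr_gt0.
move: qb; rewrite ler_pdivrMr// => qb.
have C1 : C <= `|C| * q by rewrite (le_trans (ler_norm C))// ler_peMr.
have : (K + `|C| + 1) * q <= q * (eps * c) * q by rewrite ler_wpM2r.
nra.
Unshelve. all: by end_near. Qed.

End asymptotics.

Theorem theorem3 (R : realType) (d : nat) :
  let c : R := 2 * (d.+1)%:R in
  exists C : R,
  forall (dT : measure_display) (T : measurableType dT) (P : probability T R)
    (X : nat -> {RV P >-> R}) (F : R -> R),
    mutually_independent X ->
    continuous F ->
    (forall (i : nat) (x : R), cdf (X i) x = (F x)%:E) ->
    exists pstar : forall n : nat, policy T n,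
      [/\ forall n : nat, (0 < n)%N ->
            optimal X d (pstar n) /\
            (forall q : policy T n, optimal X d q ->
               {ae P, forall w, forall i : 'I_n, q i w = pstar n i w}),
          forall n : nat, (0 < n)%N ->
            ((c `^ (1 / 2) * n%:R `^ (1 / 2)
               - c `^ (3 / 4) * (pi / 3) `^ (1 / 2) * n%:R `^ (1 / 4) - C)%:E
              < 'E_P[selection_length R (pstar n)]
              < (c `^ (1 / 2) * n%:R `^ (1 / 2))%:E)%E
        & (fun n : nat => fine 'E_P[selection_length R (pstar n)]%E : R)
            ~_\oo (fun n : nat => c `^ (1 / 2) * n%:R `^ (1 / 2))].
Proof.
move=> c; exists (4 * d.+1%:R + 1) => dT T P X F indepX contF cdfX.
have c0 : 0 <= c by rewrite mulr_ge0.
have bounds n : (0 < n)%N ->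
    c `^ (1 / 2) * n%:R `^ (1 / 2)
      - c `^ (3 / 4) * (pi / 3) `^ (1 / 2) * n%:R `^ (1 / 4) - (4 * d.+1%:R + 1)
    < value n d 1 < c `^ (1 / 2) * n%:R `^ (1 / 2).
  move=> n0; rewrite value_gt_explicit//= powR_half// powR_half//.
  exact: value_lt_sqrt.
have E n := expectation_optimal indepX contF cdfX d n.
exists (fun n => @optimal_policy _ _ _ _ X F d n); split => [n n0|n n0|].
- split; first exact: optimal_policy_optimal.
  by move=> q; exact: optimal_policy_unique.
- by rewrite E !lte_fin bounds.
- under eq_fun do rewrite E /=.
  apply: equiv_sqrt_of_bounds bounds; first by rewrite powR_gt0// mulr_gt0// ltr0n.
  by rewrite mulr_ge0// powR_ge0.
Qed.
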